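(* The decision problems Matrix Product Stability and Ap-WFA uniform continuity can be algorithmically reduced to each other.
   Context: Problems. Matrix Product Stability. Input: a finite set $\{A_a : a\in\Sigma\}$ of $n\times n$ matrices ($\Sigma$ any nonempty finite alphabet). Question: is it stable? Ap-WFA uniform continuity. Input: an average preserving WFA $\mathcal{A}$ over the binary alphabet $\{0,1\}$. Question: are both $f_{\mathcal{A}}$ (on $\{0,1\}^\omega$) and $\hat f_{\mathcal{A}}$ (on $[0,1)$) everywhere continuous (in particular everywhere defined)? Definitions. $\Sigma^*$ is the set of finite words, $\Sigma^\omega$ the set of infinite words over $\Sigma$ with metric $d_C(w,w')=2^{-k}$, $k$ the length of the longest common prefix of $w\neq w'$; $\mathrm{pref}_k(w)$ is the length-$k$ prefix of $w$. For $v=v_1\cdots v_k$, $A_v=A_{v_1}\cdots A_{v_k}$. A set $\{A_a: a\in\Sigma\}$ is stable if $\lim_{k\to\infty}A_{\mathrm{pref}_k(w)}=0$ for every $w\in\Sigma^\omega$. A WFA $\mathcal{A}$ over $\Sigma$ with $n\ge0$ states consists of $I\in\mathbb{R}^{1\times n}$, $F\in\mathbb{R}^{n\times1}$ and matrices $A_a\in\mathbb{R}^{n\times n}$ ($a\in\Sigma$); its $\omega$-function is $f_{\mathcal{A}}(w)=\lim_{k\to\infty}IA_{\mathrm{pref}_k(w)}F$, undefined where the limit does not exist. It is average preserving if $\sum_{a\in\Sigma}A_aF=|\Sigma|F$. For $\Sigma=\{0,1\}$ and $w\in\Sigma^\omega$ put $num(w)=\sum_{i\ge1}w_i2^{-i}$,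 and let $\Omega=\Sigma^\omega\setminus\Sigma^*1^\omega$. Then $num|_\Omega:\Omega\to[0,1)$ is a bijection with inverse $bin$, and $\hat f_{\mathcal{A}}(x)=f_{\mathcal{A}}(bin(x))$ for $x\in[0,1)$. Conventions. All matrix entries are given so that exact addition, multiplication, division and equality testing are algorithmic (for example, rational entries). A problem $X$ is algorithmically reducible to a problem $Y$ if there is an algorithm that decides $X$ and may call a decision procedure for $Y$ finitely many times. *)

(* Defs.v *)
From Stdlib Require Cantor.
From HB Require Import structures.
From mathcomp Require Import all_boot all_order all_algebra.
From mathcomp Require Import all_classical all_reals all_analysis.
Set Implicit Arguments.
Unset Strict Implicit.
Unset Printing Implicit Defensive.
Import Order.TTheory GRing.Theory Num.Theory.
Import numFieldNormedType.Exports.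
Local Open Scope classical_set_scope.
Local Open Scope ring_scope.

(** * Oracle algorithms, decision problems and reductions *)

Definition npair (x y : nat) : nat := Cantor.to_nat (x, y).
Definition nfst (z : nat) : nat := (Cantor.of_nat z).1.
Definition nsnd (z : nat) : nat := (Cantor.of_nat z).2.

(* Programs for the partial recursive functions relative to an oracle (Kleene).
   All functions are unary; several arguments are passed as a Cantor pair. *)
Inductive prog : Type :=
| PZero | PSucc | PFst | PSnd | POracle
| PPair of prog & prog
| PComp of prog & prog
| PRec of prog & prog
| PMu of prog.

(* [eval O c x y]: on input [x], program [c] halts with output [y]. The oracle is
   a relation: a query [q] is answered by a [y] such that [O q y], and the
   computation does not halt if there is no such [y]. *)
Fixpoint eval (O : nat -> nat -> Prop) (c : prog) (x y : nat) : Prop :=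
  match c with
  | PZero => y = 0%N
  | PSucc => y = x.+1
  | PFst => y = nfst x
  | PSnd => y = nsnd x
  | POracle => O x y
  | PPair c1 c2 => exists y1 y2 : nat,
      [/\ eval O c1 x y1, eval O c2 x y2 & y = npair y1 y2]
  | PComp c1 c2 => exists2 z : nat, eval O c2 x z & eval O c1 z y
  (* primitive recursion in the second component of [x];
     [s] lists the intermediate values *)
  | PRec c1 c2 => exists s : nat -> nat,
      [/\ eval O c1 (nfst x) (s 0%N),
          forall i, (i < nsnd x)%N ->
            eval O c2 (npair (nfst x) (npair i (s i))) (s i.+1)
        & y = s (nsnd x)]
  | PMu c1 => eval O c1 (npair x y) 0%N /\
      forall i, (i < y)%N -> exists z : nat, eval O c1 (npair x i) z.+1
  end.

Definition functional_rel (O : nat -> nat -> Prop) : Prop :=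
  forall x y z, O x y -> O x z -> y = z.

Lemma eval_functional O c : functional_rel O -> functional_rel (eval O c).
Proof.
move=> fO; elim: c => /= [|||||c IHc d IHd|c IHc d IHd|c IHc d IHd|c IHc] x y z.
- by move=> -> ->.
- by move=> -> ->.
- by move=> -> ->.
- by move=> -> ->.
- exact: fO.
- move=> H1 H2; case: H1 => [y1 [y2 [Hy1 Hy2 ->]]].
  case: H2 => [z1 [z2 [Hz1 Hz2 ->]]].
  by congr npair; eauto.
- case=> u Hu Hy [v Hv Hz]; have E := IHd _ _ _ Hu Hv.
  by rewrite -E in Hz; exact: IHc Hy Hz.
- case=> s [s0 sS ->] [t [t0 tS ->]].
  suff H i : (i <= nsnd x)%N -> s i = t i by exact: H.
  elim: i => [_|i IHi lt_i]; first exact: IHc s0 t0.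
  have Hs := sS _ lt_i; rewrite (IHi (ltnW lt_i)) in Hs.
  exact: IHd Hs (tS _ lt_i).
- case=> [Hy ltHy] [Hz ltHz].
  case: (ltngtP y z) => // lt_yz.
    by have [u Hu] := ltHz _ lt_yz; have Eu := IHc _ _ _ Hy Hu.
  by have [u Hu] := ltHy _ lt_yz; have Eu := IHc _ _ _ Hz Hu.
Qed.

(* A decision problem. [is_input] is the promise on the inputs; algorithms only
   have to be correct on codes of elements satisfying it. *)
Record problem := Problem {
  input : Type;
  is_input : input -> Prop;
  code : input -> nat;
  code_inj : injective code;
  question : input -> Prop }.

Definition answer (P : Prop) (b : nat) : Prop :=
  (P /\ b = 1%N) \/ (~ P /\ b = 0%N).

(* The decision procedure for [Y]; it answers only on codes of inputs of [Y]. *)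
Definition oracle_of (Y : problem) (q b : nat) : Prop :=
  exists y : input Y, [/\ is_input y, code y = q & answer (question y) b].

Lemma oracle_of_functional Y : functional_rel (oracle_of Y).
Proof.
move=> q b c [y [_ <- Hb]] [z [_ /code_inj -> Hc]].
by case: Hb Hc => -[? ->] [] [? ->].
Qed.

Definition reducible (X Y : problem) : Prop :=
  exists c : prog, forall x : input X, is_input x ->
    exists2 b : nat, eval (oracle_of Y) c (code x) b & answer (question x) b.

Definition no_oracle (q b : nat) : Prop := False.

Definition computable (f : nat -> nat) : Prop :=
  exists c : prog, forall x, eval no_oracle c x (f x).

(** * Effectively given numbers *)

(* A numbering of a subfield of [R] (the range of [val]) for which addition,
   multiplication, division and equality are computable on codes. A number may
   have several codes. Closure under opposites comes from [val_m1]. *)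
Record numbering (R : realType) := Numbering {
  val : nat -> R;
  val_m1 : exists x, val x = -1;
  add_computable : exists2 f, computable f &
    forall x y, val (f (npair x y)) = val x + val y;
  mul_computable : exists2 f, computable f &
    forall x y, val (f (npair x y)) = val x * val y;
  div_computable : exists2 f, computable f &
    forall x y, val y != 0 -> val (f (npair x y)) = val x / val y;
  eq_computable : exists2 f, computable f &
    forall x y, f (npair x y) = (val x == val y) :> nat }.

(** * Words and matrix products *)

Definition pref (T : Type) (k : nat) (w : nat -> T) : seq T := mkseq w k.

Definition mxword (R : pzRingType) (T : Type) (n : nat) (A : T -> 'M[R]_n)
  (v : seq T) : 'M[R]_n := \big[mulmx/1%:M]_(a <- v) A a.

Definition stable (R : realType) (T : Type) (n : nat) (A : T -> 'M[R]_n) : Prop :=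
  forall w : nat -> T,
    (fun k => mxword A (pref k w)) @ \oo --> (0 : 'M[R]_n).

(* 2 ^- k for the first position [k] at which the words differ *)
Definition dC (R : realType) (T : eqType) (w w' : nat -> T) : R :=
  if pselect (exists i, w i != w' i) is left h then 2 ^- ex_minn h else 0.

Definition continuous_dC (R : realType) (T : eqType) (f : (nat -> T) -> R) : Prop :=
  forall (w : nat -> T) (e : R), 0 < e ->
    exists2 d : R, 0 < d & forall w', dC R w w' < d -> `|f w - f w'| < e.

(** * Weighted finite automata *)

Record wfa (K : Type) (S : finType) := Wfa {
  states : nat;
  init : 'rV[K]_states;
  final : 'cV[K]_states;
  trans : S -> 'M[K]_states }.

Definition map_wfa (K L : Type) (S : finType) (g : K -> L) (A : wfa K S) : wfa L S :=
  Wfa (map_mx g (init A)) (map_mx g (final A)) (fun a => map_mx g (trans A a)).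

Definition average_preserving (R : realType) (S : finType) (A : wfa R S) : Prop :=
  \sum_(a : S) (trans A a *m final A) = #|S|%:R *: final A.

Section OmegaFunction.
Variables (R : realType) (S : finType) (A : wfa R S).

Definition omega_seq (w : nat -> S) (k : nat) : R :=
  (init A *m mxword (trans A) (pref k w) *m final A) ord0 ord0.

(* [omega_fun] takes a default value outside [omega_defined]. *)
Definition omega_defined (w : nat -> S) : Prop := cvgn (omega_seq w).
Definition omega_fun (w : nat -> S) : R := limn (omega_seq w).

End OmegaFunction.

(** * Binary expansions *)

(* The digits are indexed from 0. *)
Definition num (R : realType) (w : nat -> bool) : R :=
  limn (series (fun i => (w i)%:R * 2 ^- i.+1 : R)).

Definition Omega : set (nat -> bool) :=
  [set w | ~ exists k, forall i, (k <= i)%N -> w i = true].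

(* The inverse of [num] on [Omega]; the default is irrelevant for 0 <= x < 1. *)
Definition bin (R : realType) (x : R) : nat -> bool :=
  xget (fun=> false) [set w | Omega w /\ num R w = x].

Definition hat_defined (R : realType) (A : wfa R bool) (x : R) : Prop :=
  omega_defined A (bin x).
Definition hat_fun (R : realType) (A : wfa R bool) (x : R) : R :=
  omega_fun A (bin x).

Definition everywhere_continuous (R : realType) (A : wfa R bool) : Prop :=
  ((forall w, omega_defined A w) /\ continuous_dC (omega_fun A)) /\
  ((forall x : R, 0 <= x < 1 -> hat_defined A x) /\
   {within `[0, 1[, continuous (hat_fun A)}).

(** * Codes of inputs *)

Fixpoint code_seq (s : seq nat) : nat :=
  if s is x :: s' then (npair x (code_seq s')).+1 else 0%N.

Lemma npair_inj x y x' y' : npair x y = npair x' y' -> x = x' /\ y = y'.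
Proof.
by move=> /(congr1 Cantor.of_nat); rewrite !Cantor.cancel_of_to => -[-> ->].
Qed.

Lemma code_seq_inj : injective code_seq.
Proof.
elim=> [|x s IHs] [|y t] //= /eqP; rewrite eqSS => /eqP /npair_inj [-> /IHs ->].
by [].
Qed.

Definition code_mx (m n : nat) (A : 'M[nat]_(m, n)) : nat :=
  code_seq [seq code_seq [seq A i j | j <- enum 'I_n] | i <- enum 'I_m].

Lemma code_mx_inj m n : injective (@code_mx m n).
Proof.
move=> A B /code_seq_inj /eq_in_map AB; apply/matrixP => i j.
have /code_seq_inj/eq_in_map -> // := AB i (mem_enum _ i).
exact: mem_enum.
Qed.

(* A family of [mf_card.+1] matrices over the alphabet {0, ..., mf_card}. *)
Record mx_family (K : Type) := MxFamily {
  mf_dim : nat;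
  mf_card : nat;
  mf_mx : 'I_mf_card.+1 -> 'M[K]_mf_dim }.
Arguments mf_mx {K} _ _.

Definition code_mx_family (F : mx_family nat) : nat :=
  code_seq [:: mf_dim F; mf_card F;
               code_seq [seq code_mx (mf_mx F a) | a <- enum 'I_(mf_card F).+1]].

Lemma code_mx_family_inj : injective code_mx_family.
Proof.
move=> [n k A] [n' k' A'] /code_seq_inj /= [En Ek]; subst n' k'.
move=> /code_seq_inj /eq_in_map AA'; congr MxFamily.
by apply/funext => a; apply/code_mx_inj/AA'; exact: mem_enum.
Qed.

Definition code_wfa (A : wfa nat bool) : nat :=
  code_seq [:: states A; code_mx (init A); code_mx (final A);
               code_mx (trans A false); code_mx (trans A true)].

Lemma code_wfa_inj : injective code_wfa.
Proof.
move=> [n I F A] [n' I' F' A'] /code_seq_inj /= [En]; subst n'.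
move=> /code_mx_inj <- /code_mx_inj <- /code_mx_inj A0 /code_mx_inj A1.
by congr Wfa; apply/funext => -[].
Qed.

(** * The two problems, with entries given by codes in a numbering *)

Definition matrix_product_stability (R : realType) (N : numbering R) : problem :=
  @Problem (mx_family nat) (fun=> True) code_mx_family code_mx_family_inj
    (fun F => stable (fun a => map_mx (val N) (mf_mx F a))).

Definition ap_wfa_uniform_continuity (R : realType) (N : numbering R) : problem :=
  @Problem (wfa nat bool) (fun A => average_preserving (map_wfa (val N) A))
    code_wfa code_wfa_inj
    (fun A => everywhere_continuous (map_wfa (val N) A)).

(* Main.v *)
(* Both problems reduce to a property of the function [g v = I A_v F] on finite words. For an
   average preserving automaton [g v] is the mean of the values of [g] at the children of [v], so
   it lies between the bounds of the omega-function on the cylinder of [v]; with König's lemma,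
   continuity in the Cantor metric means that [g] is uniformly Cauchy, and continuity on [0, 1[
   means in addition that [g] has the same limits along the two expansions of a dyadic rational.

   From stability to continuity: words over the alphabet are encoded in binary in such a way that
   the automaton reads a row [i], a word [v] and a column [j], and then follows a fixed saw
   function scaled by the entry [(A_v) i j]. The saw vanishes at both ends and has average [0], so
   the automaton is average preserving and agrees at dyadic points, and it is continuous exactly
   when these entries tend to [0].

   From continuity to stability: put [d = A_0 F - F]. Then [g] is uniformly Cauchy if and only if
   [I A_v d] tends to [0] with the length of [v]. Gram matrices [G] and [K] of the vectors [I A_u]
   and [A_u d], together with a generalized inverse [Z] of [G K], give a projection [K Z G] that
   compresses [A_0] and [A_1] to the reachable and observable part; the compressed pair is stable
   if and only if [I A_v d] tends to [0]. If it is stable, agreement at dyadic points is one linear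
   identity, because the sums of [A_a^k d] solve linear systems. The generalized inverses are found
   by unbounded search, which ends since they exist over the field of the given numbers. *)

From HB Require Import structures.
Require Import Defs.
From mathcomp Require Import all_boot all_order all_algebra.
From mathcomp Require Import all_classical all_reals all_analysis.
From mathcomp Require Import zify ring lra.
Set Implicit Arguments.
Unset Strict Implicit.
Unset Printing Implicit Defensive.
Import Order.TTheory GRing.Theory Num.Theory.
Import numFieldNormedType.Exports.

(* These names also occur in MathComp and MathComp-Analysis. *)
Local Notation eval := Defs.eval.
Local Notation num := Defs.num.
Local Notation val := Defs.val.

(** * Computable functions *)

Lemma nfst_npair x y : nfst (npair x y) = x.
Proof. by rewrite /nfst /npair Cantor.cancel_of_to. Qed.

Lemma nsnd_npair x y : nsnd (npair x y) = y.
Proof. by rewrite /nsnd /npair Cantor.cancel_of_to. Qed.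

Lemma npairK z : npair (nfst z) (nsnd z) = z.
Proof.
by rewrite /npair /nfst /nsnd -surjective_pairing Cantor.cancel_to_of.
Qed.

Lemma nfst0 : nfst 0 = 0. Proof. by []. Qed.
Lemma nsnd0 : nsnd 0 = 0. Proof. by []. Qed.

Opaque npair nfst nsnd.

Definition npairE := (nfst_npair, nsnd_npair).

(** A computation that halts with the empty oracle has made no query, so it runs unchanged under
    every oracle. Computable functions thus serve as subprograms of reductions. *)
Lemma eval_no_oracle O c x y : eval no_oracle c x y -> eval O c x y.
Proof.
elim: c x y => //= [c IHc d IHd|c IHc d IHd|c IHc d IHd|c IHc] x y.
- by case=> y1 [y2 [/IHc H1 /IHd H2 ->]]; exists y1, y2.
- by case=> z /IHd Hz /IHc Hy; exists z.
- case=> s [/IHc s0 sS ->]; exists s; split=> // i /sS; exact: IHd.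
- case=> /IHc Hy Hlt; split=> // i /Hlt [z /IHc Hz]; by exists z.
Qed.

Section Closure.

Implicit Types f g b n : nat -> nat.

Lemma computable_ext f g : f =1 g -> computable f -> computable g.
Proof. by move=> fg [c Hc]; exists c => x; rewrite -fg. Qed.

(** No instruction is the identity; unpairing and pairing again is, since the Cantor pairing is
    onto. *)
Lemma computable_id : computable (fun x => x).
Proof. by exists (PPair PFst PSnd) => x /=; exists (nfst x), (nsnd x); rewrite npairK. Qed.

Lemma computable_comp f g :
  computable f -> computable g -> computable (fun x => f (g x)).
Proof. by move=> [c Hc] [d Hd]; exists (PComp c d) => x /=; exists (g x). Qed.

Lemma computable_fst f : computable f -> computable (fun x => nfst (f x)).
Proof. by apply: computable_comp; exists PFst. Qed.

Lemma computable_snd f : computable f -> computable (fun x => nsnd (f x)).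
Proof. by apply: computable_comp; exists PSnd. Qed.

Lemma computable_succ f : computable f -> computable (fun x => (f x).+1).
Proof. by apply: (computable_comp (f := succn)); exists PSucc. Qed.

Lemma computable_pair f g : computable f -> computable g ->
  computable (fun x => npair (f x) (g x)).
Proof. by move=> [c Hc] [d Hd]; exists (PPair c d) => x /=; exists (f x), (g x). Qed.

Lemma computable_cst k : computable (fun=> k).
Proof.
elim: k => [|k IHk]; first by exists PZero.
exact: computable_succ IHk.
Qed.

Lemma computable2 (F : nat -> nat -> nat) f g :
  computable (fun z => F (nfst z) (nsnd z)) -> computable f -> computable g ->
  computable (fun x => F (f x) (g x)).
Proof.
move=> cF cf cg; apply: computable_ext (computable_comp cF (computable_pair cf cg)).
by move=> x /=; rewrite !npairE.
Qed.

(** The whole input is kept as the parameter of [PRec], so that the step may depend on it. *)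
Lemma computable_iteri n b (step : nat -> nat -> nat -> nat) :
  computable n ->
  computable (fun z => step (nfst z) (nfst (nsnd z)) (nsnd (nsnd z))) ->
  computable b ->
  computable (fun x => iteri (n x) (step x) (b x)).
Proof.
move=> [cn Hn] [cs Hs] [cb Hb].
have [ci Hi] := computable_id.
exists (PComp (PRec cb cs) (PPair ci cn)) => x /=.
exists (npair x (n x)); first by exists x, (n x).
exists (fun i => iteri i (step x) (b x)); rewrite !npairE; split=> // i _.
by have := Hs (npair x (npair i (iteri i (step x) (b x)))); rewrite !npairE.
Qed.

(** The condition, read as 0 or 1, is the length of a loop whose step ignores the accumulator. *)
Lemma computable_if (c : nat -> bool) f g :
  computable (fun x => c x : nat) -> computable f -> computable g ->
  computable (fun x => if c x then f x else g x).
Proof.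
move=> cc cf cg.
apply: (@computable_ext (fun x => iteri (c x) (fun _ _ => f x) (g x))).
  by move=> x; case: (c x).
apply: computable_iteri => //.
exact: (computable_comp cf (computable_fst computable_id)).
Qed.

(** [PMu] looks for a zero, so the program under search computes the negation of [P]. The value
    found is the least witness. *)
Lemma computable_mu (P : nat -> nat -> bool) :
  computable (fun z => P (nfst z) (nsnd z) : nat) ->
  (forall x, exists y, P x y) ->
  exists2 f, computable f & forall x, P x (f x).
Proof.
move=> cP exP; pose f x := ex_minn (exP x).
have [c Hc] : computable (fun z => ~~ P (nfst z) (nsnd z) : nat).
  apply: (@computable_ext (fun z => if P (nfst z) (nsnd z) then 0 else 1)).
    by move=> z; case: (P _ _).
  by apply: computable_if => //; apply: computable_cst.
exists f; last by move=> x; rewrite /f; case: ex_minnP.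
exists (PMu c) => x /=; rewrite /f; case: ex_minnP => y Py minP.
have := Hc (npair x y); rewrite !npairE Py; split=> // i lt_iy.
have NPi : ~~ P x i by apply: contraTN lt_iy => /minP; rewrite -leqNgt.
by exists 0; have := Hc (npair x i); rewrite !npairE NPi.
Qed.

End Closure.

Create HintDb comp.
#[local] Hint Resolve computable_id computable_fst computable_snd computable_succ
  computable_pair computable_cst : comp.

Lemma computable_pred f : computable f -> computable (fun x => (f x).-1).
Proof.
apply: (computable_comp (f := predn)).
(* The loop returns its last index. *)
apply: (@computable_ext (fun n => iteri n (fun i _ => i) 0)); first by case.
by apply: computable_iteri; auto with comp.
Qed.
#[local] Hint Resolve computable_pred : comp.

Lemma computable_addn f g :
  computable f -> computable g -> computable (fun x => f x + g x).
Proof.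
move=> cf cg; apply: (@computable_ext (fun x => iteri (f x) (fun _ => succn) (g x))).
  by move=> x; elim: (f x) => //= n ->.
by apply: computable_iteri; auto with comp.
Qed.
#[local] Hint Resolve computable_addn : comp.

Lemma computable_subn f g :
  computable f -> computable g -> computable (fun x => f x - g x).
Proof.
move=> cf cg; apply: (@computable_ext (fun x => iteri (g x) (fun _ => predn) (f x))).
  by move=> x; elim: (g x) => [|n /= ->]; rewrite ?subn0 // subnS.
by apply: computable_iteri; auto with comp.
Qed.
#[local] Hint Resolve computable_subn : comp.

Lemma computable_muln f g :
  computable f -> computable g -> computable (fun x => f x * g x).
Proof.
move=> cf cg; apply: (@computable_ext (fun x => iteri (f x) (fun _ m => g x + m) 0)).
  by move=> x; elim: (f x) => //= n ->; rewrite mulSn.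
apply: computable_iteri => //; last by auto with comp.
apply: computable_addn; last by auto with comp.
exact: (computable_comp cg (computable_fst computable_id)).
Qed.
#[local] Hint Resolve computable_muln : comp.

Lemma computable_eq0 f : computable f -> computable (fun x => f x == 0 : nat).
Proof.
move=> cf; apply: (@computable_ext (fun x => 1 - f x)); last by auto with comp.
by move=> x; case: (f x).
Qed.

Lemma computable_leq f g :
  computable f -> computable g -> computable (fun x => f x <= g x : nat).
Proof. by move=> cf cg; rewrite /leq; apply: computable_eq0; auto with comp. Qed.
#[local] Hint Resolve computable_leq : comp.

Lemma computable_andb (b c : nat -> bool) :
  computable (fun x => b x : nat) -> computable (fun x => c x : nat) ->
  computable (fun x => b x && c x : nat).
Proof.
move=> cb cc; apply: (@computable_ext (fun x => b x * c x)); last by auto with comp.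
by move=> x; rewrite mulnb.
Qed.
#[local] Hint Resolve computable_andb : comp.

Lemma computable_eqn f g :
  computable f -> computable g -> computable (fun x => f x == g x : nat).
Proof.
move=> cf cg; apply: (@computable_ext (fun x => (f x <= g x) && (g x <= f x) : nat)).
  by move=> x; rewrite -eqn_leq.
by auto with comp.
Qed.
#[local] Hint Resolve computable_eqn computable_if : comp.

Lemma computable_modn f g :
  computable f -> computable g -> computable (fun x => f x %% g x).
Proof.
apply: computable2.
(* The remainder counts up and is reset at the divisor; a zero divisor never resets it, in
   accordance with [modn0]. *)
apply: (@computable_ext (fun z => iteri (nfst z)
   (fun _ r => if r.+1 == nsnd z then 0 else r.+1) 0)); last first.
  by apply: computable_iteri; auto 10 with comp.
move=> z; move: (nfst z) (nsnd z) => m d; elim: m => [|m /= ->]; first by rewrite mod0n.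
rewrite modnS; case: ifP => [/eqP E|/negP E].
  by have -> : d %| m.+1 by rewrite /dvdn -addn1 -modnDml addn1 E modnn.
case: ifP => // dm; case: E; move: dm; rewrite /dvdn -addn1 -modnDml addn1.
case: d => [|d]; first by rewrite !modn0.
have := ltn_pmod m (ltn0Sn d); rewrite leq_eqVlt => /orP[//|lt].
by rewrite modn_small.
Qed.
#[local] Hint Resolve computable_modn : comp.

Lemma computable_divn f g :
  computable f -> computable g -> computable (fun x => f x %/ g x).
Proof.
apply: computable2.
(* The quotient counts the positive multiples of the divisor up to the dividend. *)
apply: (@computable_ext (fun z => iteri (nfst z)
   (fun i q => (i.+1 %% nsnd z == 0) + q) 0)); last first.
  by apply: computable_iteri; auto 10 with comp.
move=> z; move: (nfst z) (nsnd z) => m [|d].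
  by rewrite divn0; elim: m => //= m ->; rewrite modn0.
by elim: m => [|m /= ->]; rewrite ?div0n // divnS.
Qed.
#[local] Hint Resolve computable_divn : comp.

(** * Coded lists and matrices *)

(** The code of a nonempty list is the successor of a pair, so the tail is [nsnd] of the
    predecessor. The code 0 of the empty list is fixed by this operation, and reading past the end
    gives 0. *)
Definition nthc (s i : nat) : nat := nfst (iter i (fun s => nsnd s.-1) s).-1.

Lemma nthc_code s i : nthc (code_seq s) i = nth 0 s i.
Proof.
rewrite /nthc; elim: s i => [|x s IHs] [|i].
- exact: nfst0.
- rewrite nth_nil; suff -> : iter i.+1 (fun s => nsnd s.-1) 0 = 0 by apply: nfst0.
  by elim: i.+1 => //= j ->; apply: nsnd0.
- by rewrite /= npairE.
- by rewrite iterSr /= npairE IHs.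
Qed.

Lemma computable_nthc f g :
  computable f -> computable g -> computable (fun x => nthc (f x) (g x)).
Proof.
move=> cf cg.
apply: (@computable_ext
  (fun x => nfst (iteri (g x) (fun _ s => nsnd s.-1) (f x)).-1)).
  by move=> x; rewrite /nthc; congr (nfst _.-1); elim: (g x) => //= n ->.
by apply: computable_fst; apply: computable_pred; apply: computable_iteri; auto with comp.
Qed.
#[local] Hint Resolve computable_nthc : comp.

Definition tabc (n : nat) (f : nat -> nat) : nat := code_seq (mkseq f n).

Lemma nthc_tabc n f i : i < n -> nthc (tabc n f) i = f i.
Proof. by move=> lt; rewrite nthc_code nth_mkseq. Qed.

Lemma computable_tabc n (f : nat -> nat -> nat) : computable n ->
  computable (fun z => f (nfst z) (nsnd z)) ->
  computable (fun x => tabc (n x) (f x)).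
Proof.
(* The list is built from its last element backwards, whence the reversed index. *)
move=> cn cf; apply: (@computable_ext (fun x => iteri (n x)
    (fun i s => (npair (f x ((n x).-1 - i)) s).+1) 0)).
  move=> x; rewrite /tabc /mkseq.
  suff H k : k <= n x -> iteri k (fun i s => (npair (f x ((n x).-1 - i)) s).+1) 0
      = code_seq [seq f x i | i <- iota (n x - k) k].
    by rewrite (H (n x)) // subnn.
  elim: k => // k IHk lt_k; rewrite [LHS]/= IHk ?(ltnW lt_k) //=.
  have -> : (n x).-1 - k = n x - k.+1 by lia.
  by have -> : (n x - k.+1).+1 = n x - k by lia.
apply: computable_iteri; auto with comp.
apply: computable_succ; apply: computable_pair; last by auto with comp.
apply: (computable2 cf); auto with comp.
apply: computable_subn; auto with comp.
by apply: computable_pred; apply: (computable_comp cn); auto with comp.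
Qed.

Definition ent (M i j : nat) : nat := nthc (nthc M i) j.

Definition tabmx (m n : nat) (f : nat -> nat -> nat) : nat :=
  tabc m (fun i => tabc n (f i)).

Lemma ent_tabmx m n f i j : i < m -> j < n -> ent (tabmx m n f) i j = f i j.
Proof. by move=> im jn; rewrite /ent !nthc_tabc. Qed.

Lemma computable_ent f g h : computable f -> computable g -> computable h ->
  computable (fun x => ent (f x) (g x) (h x)).
Proof. by rewrite /ent; auto with comp. Qed.
#[local] Hint Resolve computable_ent : comp.

Lemma computable_tabmx m n (f : nat -> nat -> nat -> nat) :
  computable m -> computable n ->
  computable (fun z => f (nfst z) (nfst (nsnd z)) (nsnd (nsnd z))) ->
  computable (fun x => tabmx (m x) (n x) (f x)).
Proof.
move=> cm cn cf; apply: computable_tabc => //.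
apply: (@computable_tabc (fun z => n (nfst z)) (fun z j => f (nfst z) (nsnd z) j)).
  by apply: (computable_comp cn); auto with comp.
have /= := computable_comp cf (g := fun z => npair (nfst (nfst z)) (npair (nsnd (nfst z)) (nsnd z))).
move=> H; apply: computable_ext (H _); last by auto 10 with comp.
by move=> z /=; rewrite !npairE.
Qed.

Lemma code_mxE (m n : nat) (A : 'M[nat]_(m, n)) (f : nat -> nat -> nat) :
  (forall i j, A i j = f i j) -> code_mx A = tabmx m n f.
Proof.
move=> Af; rewrite /code_mx /tabmx /tabc /mkseq; congr code_seq.
rewrite -(val_enum_ord m) -map_comp; apply/eq_map => i /=.
rewrite -(val_enum_ord n) -map_comp; congr code_seq.
by apply/eq_map => j /=.
Qed.

Lemma ent_code_mx (m n : nat) (A : 'M[nat]_(m, n)) (i : 'I_m) (j : 'I_n) :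
  ent (code_mx A) i j = A i j.
Proof.
(* The entries are extended to all pairs of natural numbers, by 0 outside the range. *)
rewrite (@code_mxE _ _ A (fun i j => if insub i is Some i' then
   if insub j is Some j' then A i' j' else 0 else 0)).
  by rewrite ent_tabmx ?ltn_ord // !valK.
by move=> i' j'; rewrite !valK.
Qed.

Lemma code_mx_ent (m n : nat) (f : nat -> nat -> nat) :
  code_mx (\matrix_(i < m, j < n) ent (tabmx m n f) i j)%R = tabmx m n f.
Proof. by apply: code_mxE => i j; rewrite !mxE ent_tabmx. Qed.

(* Matching is syntactic because unification would unfold [npair], [ent], ... *)
Ltac computability_step :=
  cbv beta; first
  [ assumption
  | lazymatch goal with
    | |- computable (fun=> ?k) => apply: computable_cst
    | |- computable (fun x => x) => apply: computable_id
    | |- computable nfst => apply: computable_fst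
    | |- computable nsnd => apply: computable_snd
    | |- computable (fun x => nfst _) => apply: computable_fst
    | |- computable (fun x => nsnd _) => apply: computable_snd
    | |- computable (fun x => npair _ _) => apply: computable_pair
    | |- computable (fun x => S _) => apply: computable_succ
    | |- computable (fun x => _ .-1)%N => apply: computable_pred
    | |- computable (fun x => _ + _)%N => apply: computable_addn
    | |- computable (fun x => _ - _)%N => apply: computable_subn
    | |- computable (fun x => _ * _)%N => apply: computable_muln
    | |- computable (fun x => _ %% _)%N => apply: computable_modn
    | |- computable (fun x => _ %/ _)%N => apply: computable_divn
    | |- computable (fun x => nat_of_bool (_ <= _)%N) => apply: computable_leq
    | |- computable (fun x => nat_of_bool (_ == _)) => apply: computable_eqn
    | |- computable (fun x => nat_of_bool (_ && _)) => apply: computable_andb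
    | |- computable (fun x => if _ then _ else _) => apply: computable_if
    | |- computable (fun x => nthc _ _) => apply: computable_nthc
    | |- computable (fun x => ent _ _ _) => apply: computable_ent
    | |- computable (fun x => tabc _ _) => apply: computable_tabc
    | |- computable (fun x => tabmx _ _ _) => apply: computable_tabmx
    end
  | match goal with H : computable ?f |- computable (fun x => ?f (@?g x)) =>
      apply: (computable_comp H) end ].

Local Open Scope classical_set_scope.
Local Open Scope ring_scope.

(** * Words and the Cantor space *)

Section Words.
Variable T : Type.
Implicit Types (u v : seq T) (w : nat -> T).

Lemma size_pref k w : size (pref k w) = k.
Proof. exact: size_mkseq. Qed.

Lemma pref_add k l w : pref (k + l) w = pref k w ++ pref l (fun i => w (k + i)%N).
Proof.
rewrite /pref /mkseq iotaD map_cat add0n; congr (_ ++ _).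
by rewrite -[X in iota X l]addn0 iotaDl -map_comp.
Qed.

Lemma pref_split k l w : (k <= l)%N -> exists v, pref l w = pref k w ++ v.
Proof. by move=> le_kl; rewrite -(subnKC le_kl) pref_add; eexists. Qed.

Lemma pref_eqP k w w' :
  pref k w = pref k w' <-> forall i, (i < k)%N -> w i = w' i.
Proof.
split=> [E i lt_ik|E].
  have := congr1 (fun s => nth (w 0) s i) E.
  by rewrite /pref !nth_mkseq.
by apply/eq_in_map => i; rewrite mem_iota => /andP[_]; exact: E.
Qed.

(** Dependent choice: the successive choices of a next letter are strung together into one infinite
    word. *)
Lemma path_extend (P : seq T -> Prop) v :
  P v -> (forall u, P u -> exists a, P (rcons u a)) ->
  exists w, pref (size v) w = v /\ forall k, (size v <= k)%N -> P (pref k w).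
Proof.
move=> Pv PS; have [a0 _] := PS _ Pv.
have /choice[nxt nxtP] : forall u, exists a, P u -> P (rcons u a).
  move=> u; have [Pu|nPu] := pselect (P u); last by exists a0.
  by have [a Pa] := PS _ Pu; exists a.
pose u k := iter k (fun s => rcons s (nxt s)) v.
have size_u k : size (u k) = (size v + k)%N.
  by elim: k => [|k IHk]; rewrite ?addn0 //= size_rcons IHk addnS.
have Pu k : P (u k) by elim: k => //= k IHk; exact: nxtP.
pose w i := if (i < size v)%N then nth a0 v i else nxt (u (i - size v)%N).
have prefw k : pref (size v + k) w = u k.
  elim: k => [|k IHk].
    rewrite addn0 /u /= -[RHS](mkseq_nth a0).
    by apply/pref_eqP => i lt_i; rewrite /w lt_i.
  by rewrite addnS /pref mkseqS -/(pref _ _) IHk /w ltnNge leq_addr /= addKn.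
exists w; split=> [|k le_vk]; first by rewrite -[size v]addn0 prefw.
by rewrite -(subnKC le_vk) prefw.
Qed.

End Words.

(* König's lemma, for properties of words that are inherited by extensions. *)
Lemma fan (T : finType) (Q : seq T -> Prop) :
  (forall u v, Q u -> Q (u ++ v)) -> (forall w, exists k, Q (pref k w)) ->
  exists D, forall v, size v = D -> Q v.
Proof.
move=> Qext barQ.
(* Some child of a word that is not [good] is not [good] either, so failure at the empty word would
   propagate along an infinite word, against [barQ]. *)
pose good u := exists D, forall v, size v = D -> Q (u ++ v).
suff: good [::] by [].
apply: contrapT => bad0.
have badS u : ~ good u -> exists a, ~ good (rcons u a).
  move=> bad; apply: contrapT => /forallNP all_good; apply: bad.
  have /choice[D DP] : forall a, exists D, forall v, size v = D -> Q (rcons u a ++ v).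
    (* If all children are good, the maximum of their lengths serves for the parent, because [Q] is
       inherited by extensions. *)
    by move=> a; exact: contrapT (all_good a).
  exists (\max_a D a).+1 => -[//|a v] [size_v].
  have le_D : (D a <= size v)%N by rewrite size_v leq_bigmax.
  rewrite -(cat_take_drop (D a) v) -cat_rcons catA; apply: Qext.
  by apply: DP; rewrite size_takel.
have [w [_ badw]] := path_extend bad0 badS.
have [k Qk] := barQ w; apply: (badw k) => //.
by exists 0%N => v /size0nil ->; rewrite cats0.
Qed.

Section Limits.
Variable R : realType.
Implicit Types u : nat -> R.

Definition tends0 u : Prop :=
  forall e : R, 0 < e -> exists K, forall k, (K <= k)%N -> `|u k| <= e.

Lemma cvgn_epsP u l : u @ \oo --> l <-> tends0 (fun k => u k - l).
Proof.
rewrite cvgrPdistC_le; split=> H e /H.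
  by case=> K _ HK; exists K => k /HK.
by case=> K HK; exists K.
Qed.

Lemma exp2N_gt0 k : 0 < 2 ^- k :> R.
Proof. by rewrite invr_gt0 exprn_gt0. Qed.

Lemma exp2N_small (e : R) : 0 < e -> exists k, forall m, (k <= m)%N -> 2 ^- m < e.
Proof.
move=> e0; have [k _ Hk] := near_infty_natSinv_expn_lt (PosNum e0).
by exists k => m /Hk /=; rewrite div1r.
Qed.

Lemma ler_small (x y : R) : (forall e : R, 0 < e -> x <= y + e) -> x <= y.
Proof. by move=> H; apply/ler_addgt0Pr. Qed.

End Limits.

(** * The Cantor metric in terms of common prefixes *)

Section CantorMetric.
Variables (R : realType) (T : eqType).
Implicit Types w : nat -> T.

Lemma dC_lt k w w' : dC R w w' < 2 ^- k -> pref k w = pref k w'.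
Proof.
rewrite /dC; case: pselect => [ex|nex] lt; apply/pref_eqP => i lt_ik; last first.
  by apply/eqP; apply: contra_notT nex => ?; exists i.
move: lt; case: ex_minnP => m _ minm; rewrite ltf_pV2 ?posrE ?exprn_gt0 //.
rewrite ltr_eXn2l ?ltr1n // => lt_km.
by apply: contraTeq lt_ik => /minm le_mi; rewrite -leqNgt ltnW // (leq_trans lt_km).
Qed.

Lemma dC_le k w w' : pref k w = pref k w' -> dC R w w' <= 2 ^- k.
Proof.
move=> /pref_eqP E; rewrite /dC; case: pselect => [ex|_]; last exact/ltW/exp2N_gt0.
case: ex_minnP => m neq _; rewrite lef_pV2 ?posrE ?exprn_gt0 //.
rewrite ler_eXn2l ?ltr1n // leqNgt; apply: contraNN neq => /E ->; exact: eqxx.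
Qed.

End CantorMetric.

(** * Functions on finite words *)

Section WordFunctions.
Variables (R : realType) (T : finType).
Implicit Types (g : seq T -> R) (w : nat -> T).

(** Compactness makes this the finite-word form of continuity. Only finite extensions occur, so no
    limit has to exist beforehand. *)
Definition unif_cauchy g : Prop := forall e : R, 0 < e ->
  exists D, forall u v v', size u = D -> `|g (u ++ v) - g (u ++ v')| <= e.

Definition limword g w : R := limn (fun k => g (pref k w)).

Lemma unif_cauchy_cvg g w : unif_cauchy g -> cvgn (fun k => g (pref k w)).
Proof.
move=> ucg; apply/cauchy_cvgP/cauchy_exP => e e0.
have [D HD] := ucg _ (divr_gt0 e0 (ltr0n R 2)).
exists (g (pref D w)); exists D => // k /= le_Dk; rewrite /ball /=.
have [v ->] := pref_split w le_Dk.
rewrite -[pref D w in X in `|X - _|]cats0 (le_lt_trans (HD _ _ _ (size_pref _ _))) //.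
by lra.
Qed.

(** From length [D] on, the prefixes of [w] are extensions of [pref D w], so the bound passes to the
    limit. *)
Lemma limword_close g e D w v : unif_cauchy g ->
  (forall u v v', size u = D -> `|g (u ++ v) - g (u ++ v')| <= e) ->
  `|g (pref D w ++ v) - limword g w| <= e.
Proof.
move=> ucg HD; apply: ler_small => d d0.
have /cvgn_epsP/(_ _ d0)[K HK] := @unif_cauchy_cvg g w ucg.
have := HK _ (leq_maxl K D); have [v' ->] := pref_split w (leq_maxr K D).
have := HD _ v v' (size_pref D w); rewrite -/(limword g w).
set a := g _; set b := g _; set c := limword _ _ => H1 H2.
by rewrite -(subrK b a) -addrA (le_trans (ler_normD _ _)) // lerD.
Qed.

Lemma unif_cauchy_continuous g : unif_cauchy g -> continuous_dC (limword g).
Proof.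
move=> ucg w e e0.
have [D HD] := ucg _ (divr_gt0 e0 (ltr0n R 3)).
exists (2 ^- D) => [|w' /dC_lt E]; first exact: exp2N_gt0.
have := limword_close w [::] ucg HD; have := limword_close w' [::] ucg HD.
rewrite -E; set a := g _; rewrite !ler_norml ltr_norml; lra.
Qed.

End WordFunctions.

(** * Functions with the mean property: from continuity to the Cauchy condition *)

Section Average.
Variables (R : realType) (g : seq bool -> R).
Hypothesis avg_g : forall v, g (rcons v false) + g (rcons v true) = 2 * g v.
Hypothesis cvg_g : forall w, cvgn (fun k => g (pref k w)).

(* Some child of a word has at least its value; so a branch on which the values do
   not decrease starts at every word. *)
Lemma average_ge v m :
  (forall w, pref (size v) w = v -> limword g w <= m) -> g v <= m.
Proof.
move=> le_m.
have child u : g v <= g u -> exists a, g v <= g (rcons u a).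
  move=> le_vu; have [le|lt] := leP (g v) (g (rcons u false)).
    by exists false.
  by exists true; have := avg_g u; lra.
have [w [prefw ge_v]] := path_extend (lexx (g v)) child.
apply: le_trans (le_m w prefw); apply: limr_ge; first exact: cvg_g.
by exists (size v) => // k /=; exact: ge_v.
Qed.

End Average.

Section AverageCauchy.
Variables (R : realType) (g : seq bool -> R).
Hypothesis avg_g : forall v, g (rcons v false) + g (rcons v true) = 2 * g v.
Hypothesis cvg_g : forall w, cvgn (fun k => g (pref k w)).

Lemma average_le v m :
  (forall w, pref (size v) w = v -> m <= limword g w) -> m <= g v.
Proof.
move=> ge_m; rewrite -lerN2; apply: (@average_ge _ (fun u => - g u)).
- by move=> u; rewrite -opprD avg_g mulrN.
- by move=> w; apply: is_cvgN; exact: cvg_g.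
- move=> w /ge_m; rewrite -lerN2 /limword limN //; exact: cvg_g.
Qed.

(** Continuity at [w] confines the limits on a cylinder around [w]. By the mean property the values
    of [g] at all extensions of the prefix are confined likewise, and [fan] makes the length of the
    prefix uniform. *)
Lemma continuous_unif_cauchy : continuous_dC (limword g) -> unif_cauchy g.
Proof.
move=> cont e e0.
(* With [v] and [v'] quantified inside, the property of [u] is inherited by extensions. *)
suff [D HD] : exists D, forall u, size u = D ->
    forall v v', `|g (u ++ v) - g (u ++ v')| <= e.
  by exists D => u v v' /HD.
apply: fan.
  by move=> u v H v1 v2; rewrite -!catA.
move=> w; have [d d0 Hd] := cont w _ (divr_gt0 e0 (ltr0n R 2)).
have [k /(_ k (leqnn k)) ltk] := exp2N_small d0.
exists k.
have near_w v : `|limword g w - g (pref k w ++ v)| <= e / 2.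
  have close w' : pref (size (pref k w ++ v)) w' = pref k w ++ v ->
      `|limword g w - limword g w'| < e / 2.
    rewrite size_cat size_pref pref_add => /eqP.
    rewrite eqseq_cat ?size_pref // => /andP[/eqP E _]; apply: Hd.
    by apply: le_lt_trans ltk; apply: dC_le.
  rewrite ler_norml; apply/andP; split.
    rewrite lerBrDr addrC -lerBrDr opprK; apply: average_ge => // w' /close.
    rewrite ltr_norml; lra.
  rewrite lerBlDr -lerBlDl; apply: average_le => w' /close.
  rewrite ltr_norml; lra.
move=> v v'; have := near_w v; have := near_w v'; rewrite !ler_norml; lra.
Qed.

End AverageCauchy.

(** * Binary expansions *)

Section BinaryWords.
Implicit Types (u s : seq bool) (w : nat -> bool).

Definition natval u : nat := foldl (fun a (b : bool) => b + a.*2)%N 0%N u.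

Lemma natval_rcons u b : natval (rcons u b) = (b + (natval u).*2)%N.
Proof. by rewrite /natval foldl_rcons. Qed.

Lemma natval_inj u u' : size u = size u' -> natval u = natval u' -> u = u'.
Proof.
elim/last_ind: u u' => [|u b IHu] u'; first by move/esym/size0nil.
case/lastP: u' => [|u' b']; rewrite ?size_rcons // => -[size_u].
rewrite !natval_rcons => E.
have Eb : b = b' by have := congr1 odd E; rewrite !oddD !odd_double !addbF !oddb.
by rewrite Eb (IHu u') //; move: E; rewrite Eb => /addnI/double_inj.
Qed.

(** The carry of adding one turns a final block [0 1^j] into [1 0^j]. These pairs of words name
    adjacent dyadic intervals. *)
Lemma natval_succ u u' : size u = size u' -> natval u' = (natval u).+1 ->
  exists s j, u = s ++ false :: nseq j true /\ u' = s ++ true :: nseq j false.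
Proof.
elim/last_ind: u u' => [|u b IHu] u'; first by move/esym/size0nil ->.
case/lastP: u' => [|u' b']; rewrite ?size_rcons // => -[size_u].
rewrite !natval_rcons => E.
have: b = ~~ b' by have := congr1 odd E; rewrite !oddS !oddD !odd_double !addbF !oddb => ->; rewrite negbK.
case: b' E => E Eb; rewrite Eb in E *.
  exists u, 0%N; rewrite /= !cats1; split=> //; congr rcons.
  by apply/esym/natval_inj => //; move: E; rewrite /= add0n add1n => -[/double_inj].
have [|s [j [-> ->]]] := IHu u' size_u.
  by apply: double_inj; move: E; rewrite /= doubleS; lia.
exists s, j.+1; rewrite !rcons_cat /=; split; congr (_ ++ _ :: _).
- by rewrite -cats1 -[[:: true]]/(nseq 1 true) -nseqD addn1.
- by rewrite -cats1 -[[:: false]]/(nseq 1 false) -nseqD addn1.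
Qed.

Definition cat_stream u w (i : nat) : bool :=
  if (i < size u)%N then nth false u i else w (i - size u)%N.

Lemma pref_cat_stream u w k : pref (size u + k) (cat_stream u w) = u ++ pref k w.
Proof.
rewrite pref_add; congr (_ ++ _).
  rewrite -[RHS](mkseq_nth false); apply/pref_eqP => i lt_i.
  by rewrite /cat_stream lt_i.
by apply/pref_eqP => i _; rewrite /cat_stream ltnNge leq_addr addKn.
Qed.

Lemma pref_size_cat_stream u w : pref (size u) (cat_stream u w) = u.
Proof. by have := pref_cat_stream u w 0; rewrite addn0 cats0. Qed.

Lemma pref_cst k (b : bool) : pref k (fun=> b) = nseq k b.
Proof.
apply: (@eq_from_nth _ b); rewrite ?size_pref ?size_nseq // => i lt_i.
by rewrite nth_mkseq // nth_nseq lt_i.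
Qed.

Lemma Omega_cat_stream u : Omega (cat_stream u (fun=> false)).
Proof.
case=> k /(_ (size u + k)%N); rewrite leq_addl => /(_ isT).
by rewrite /cat_stream ltnNge leq_addr.
Qed.

End BinaryWords.

Section BinaryExpansion.
Variable R : realType.
Implicit Types (w : nat -> bool) (x : R).

(** [num_lo] and [num_hi] are the ends of the dyadic interval of length [2 ^- k] that belongs to the
    prefix; these intervals are nested around [num R w]. *)
Definition num_lo w k : R := (natval (pref k w))%:R * 2 ^- k.
Definition num_hi w k : R := (natval (pref k w)).+1%:R * 2 ^- k.

Lemma exp2N_half k : 2 ^- k.+1 = 2 ^- k / 2 :> R.
Proof. by rewrite exprS invfM mulrC. Qed.

Lemma num_hiE w k : num_hi w k = num_lo w k + 2 ^- k.
Proof. by rewrite /num_hi /num_lo -natr1 mulrDl mul1r. Qed.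

Lemma num_loS w k : num_lo w k.+1 = num_lo w k + (w k)%:R * 2 ^- k.+1.
Proof.
rewrite /num_lo /pref mkseqS natval_rcons natrD mulrDl addrC; congr (_ + _).
by rewrite -muln2 natrM exp2N_half; field.
Qed.

Lemma num_loE w k : series (fun i => (w i)%:R * 2 ^- i.+1 : R) k = num_lo w k.
Proof.
elim: k => [|k IHk]; first by rewrite /series /= big_geq // /num_lo mul0r.
by rewrite seriesSr IHk num_loS.
Qed.

Lemma num_lo_nd w k l : (k <= l)%N -> num_lo w k <= num_lo w l.
Proof.
move/subnKC <-; elim: (l - k)%N => [|m IHm]; rewrite ?addn0 // addnS num_loS.
by rewrite (le_trans IHm) // lerDl mulr_ge0 ?ler0n // ltW // exp2N_gt0.
Qed.

Lemma num_hiS w k : num_hi w k.+1 = num_hi w k - (~~ w k)%:R * 2 ^- k.+1.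
Proof. by rewrite !num_hiE num_loS exp2N_half; case: (w k) => /=; field. Qed.

Lemma num_hi_ni w k l : (k <= l)%N -> num_hi w l <= num_hi w k.
Proof.
move/subnKC <-; elim: (l - k)%N => [|m IHm]; rewrite ?addn0 // addnS num_hiS.
by apply: le_trans IHm; rewrite gerBl mulr_ge0 ?ler0n // ltW // exp2N_gt0.
Qed.

Lemma num_lo_le_hi w k l : num_lo w k <= num_hi w l.
Proof.
apply: le_trans (num_lo_nd _ (leq_maxl k l)) _.
apply: le_trans (num_hi_ni _ (leq_maxr k l)).
by rewrite num_hiE lerDl ltW // exp2N_gt0.
Qed.

Lemma cvg_num w : cvgn (num_lo w).
Proof.
apply: nondecreasing_is_cvgn; first by move=> k l; exact: num_lo_nd.
by exists (num_hi w 0) => _ [k _ <-]; exact: num_lo_le_hi.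
Qed.

Lemma numE w : num R w = limn (num_lo w).
Proof. by rewrite /num; congr (limn _); apply/funext => k; rewrite num_loE. Qed.

Lemma num_ge w k : num_lo w k <= num R w.
Proof.
rewrite numE; apply: nondecreasing_cvgn_le; last exact: cvg_num.
by move=> i j; exact: num_lo_nd.
Qed.

Lemma num_le w k : num R w <= num_hi w k.
Proof.
rewrite numE; apply: limr_le; first exact: cvg_num.
by apply: nearW => i; exact: num_lo_le_hi.
Qed.

(** A digit 0 beyond position [k] exists, and there the upper end strictly decreases. *)
Lemma num_lt w k : Omega w -> num R w < num_hi w k.
Proof.
move=> Ow; have [i [le_ki wi]] : exists i, (k <= i)%N /\ w i = false.
  apply: contrapT => /forallNP nex; apply: Ow; exists k => i le_ki.
  by have := nex i; case: (w i) => // -[].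
apply: le_lt_trans (num_le _ i.+1) _; apply: lt_le_trans (num_hi_ni _ le_ki).
by rewrite num_hiS wi mul1r gtrBl exp2N_gt0.
Qed.

(** On [Omega] the dyadic intervals are half-open, so the number determines the interval of each
    length and with it every prefix. *)
Lemma num_inj w w' : Omega w -> Omega w' -> num R w = num R w' -> w = w'.
Proof.
move=> Ow Ow' E; apply/funext => i.
suff: pref i.+1 w = pref i.+1 w' by move/pref_eqP; apply.
have H1 : num_lo w i.+1 < num_hi w' i.+1.
  by apply: le_lt_trans (num_lt _ Ow'); rewrite -E num_ge.
have H2 : num_lo w' i.+1 < num_hi w i.+1.
  by apply: le_lt_trans (num_lt _ Ow); rewrite E num_ge.
apply: natval_inj; first by rewrite !size_pref.
move: H1 H2; rewrite /num_lo /num_hi !ltr_pM2r ?exp2N_gt0 // !ltr_nat !ltnS.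
by move=> H1 H2; apply/eqP; rewrite eqn_leq H1.
Qed.

Lemma num_surj x : 0 <= x < 1 -> exists w, Omega w /\ num R w = x.
Proof.
case/andP=> x0 x1; pose t k := Num.trunc (2 ^+ k * x).
have tP k : (t k)%:R <= 2 ^+ k * x < (t k).+1%:R.
  by rewrite truncn_itv // mulr_ge0 // exprn_ge0.
(* The digit of weight [2 ^- k.+1] is the parity of the integer part of [2 ^+ k.+1 * x]. *)
pose w k := odd (t k.+1).
have tE k : t k = natval (pref k w).
  elim: k => [|k IHk].
    apply/eqP; have := tP 0; rewrite expr0 mul1r => /andP[lt _].
    by rewrite -leqn0 -ltnS -(ltr_nat R) (le_lt_trans lt).
  rewrite /pref mkseqS natval_rcons -[mkseq w k]/(pref k w) -IHk /w.
  have /andP[H1 H2] := tP k; have /andP[H3 H4] := tP k.+1.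
  rewrite exprS -mulrA in H3 H4.
  have le1 : ((t k).*2 < (t k.+1).+1)%N.
    rewrite -(ltr_nat R) (le_lt_trans _ H4) // -mul2n natrM.
    by rewrite ler_pM2l.
  have le2 : (t k.+1 < (t k).+1.*2)%N.
    rewrite -(ltr_nat R) (le_lt_trans H3) // -mul2n natrM.
    by rewrite ltr_pM2l.
  rewrite -[LHS]odd_double_half; congr (_ + _.*2)%N; lia.
have bnd k : num_lo w k <= x < num_hi w k.
  rewrite /num_lo /num_hi -tE; have := tP k.
  by rewrite ler_pdivrMr ?exprn_gt0 // ltr_pdivlMr ?exprn_gt0 // mulrC.
exists w; split.
  (* If all digits from [k] on were 1, the upper ends would be constant from there; yet they come
     arbitrarily close to [x] while staying above it. *)
  case=> k wk; have /andP[_ ltx] := bnd k.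
  have hiE m : num_hi w (k + m) = num_hi w k.
    elim: m => [|m IHm]; first by rewrite addn0.
    by rewrite addnS num_hiS IHm wk ?leq_addr //= mul0r subr0.
  have gap : 0 < num_hi w k - x by rewrite subr_gt0.
  have [m /(_ (k + m)%N (leq_addl _ _)) ltm] := exp2N_small gap.
  have := bnd (k + m)%N; have := hiE m; rewrite num_hiE; lra.
apply/eqP; rewrite eq_le; apply/andP; split; apply: ler_small => e e0.
  have [k /(_ k (leqnn k)) ltk] := exp2N_small e0.
  by have := num_le w k; have /andP[] := bnd k; rewrite num_hiE; lra.
have [k /(_ k (leqnn k)) ltk] := exp2N_small e0.
by have := num_ge w k; have /andP[] := bnd k; rewrite num_hiE; lra.
Qed.

Lemma bin_spec x : 0 <= x < 1 -> Omega (bin x) /\ num R (bin x) = x.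
Proof. by move=> /num_surj; apply: (@xgetPex _ (fun=> false)). Qed.

Lemma num_itv w : Omega w -> 0 <= num R w < 1.
Proof.
move=> Ow; have := num_ge w 0; have := num_lt 0 Ow.
by rewrite /num_lo /num_hi /= expr0 invr1 mul0r mul1r => -> ->.
Qed.

Lemma bin_num w : Omega w -> bin (num R w) = w.
Proof. by move=> Ow; have [Ob Eb] := bin_spec (num_itv Ow); apply: num_inj. Qed.

(** Numbers less than [2 ^- k] apart lie in the same or in adjacent dyadic intervals of that length;
    [natval_succ] describes the adjacent ones. *)
Lemma num_close w w' k : Omega w -> Omega w' -> num R w <= num R w' ->
  num R w' - num R w < 2 ^- k -> pref k w = pref k w' \/
  exists s j, pref k w = s ++ false :: nseq j true /\
              pref k w' = s ++ true :: nseq j false.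
Proof.
move=> Ow Ow' le_num lt_num.
have := num_lt k Ow; have := num_ge w k; have := num_lt k Ow'; have := num_ge w' k.
move=> H1 H2 H3 H4.
have H5 : num_lo w k < num_hi w' k by lra.
have H6 : num_lo w' k < num_hi w k + 2 ^- k by lra.
have size_eq : size (pref k w) = size (pref k w') by rewrite !size_pref.
have {}H5 : (natval (pref k w) <= natval (pref k w'))%N.
  by move: H5; rewrite /num_lo /num_hi ltr_pM2r ?exp2N_gt0 // ltr_nat.
have {}H6 : (natval (pref k w') <= (natval (pref k w)).+1)%N.
  rewrite -ltnS -(ltr_nat R) -(ltr_pM2r (exp2N_gt0 R k)); move: H6.
  by rewrite num_hiE /num_lo -!natr1 !mulrDl !mul1r.
have [E|neq] := eqVneq (natval (pref k w)) (natval (pref k w')).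
  by left; apply: natval_inj.
by right; apply: natval_succ => //; lia.
Qed.

End BinaryExpansion.

(** * Continuity on [[0, 1[] and the two expansions of dyadic rationals *)

Section HatFunction.
Variables (R : realType) (g : seq bool -> R).
Hypothesis ucg : unif_cauchy g.

(* The words [s 0 1^k] and [s 1 0^k] tend to the two binary expansions of a dyadic rational. *)
Definition dyadic_agree : Prop := forall s,
  tends0 (fun k => g (s ++ false :: nseq k true) - g (s ++ true :: nseq k false)).

Let hat (x : R) : R := limword g (bin x).

Lemma within_continuousP (f : R -> R) :
  {within `[0, 1[, continuous f} <->
  forall x : R, 0 <= x < 1 -> forall e : R, 0 < e -> exists2 d : R, 0 < d &
    forall y : R, 0 <= y < 1 -> `|x - y| < d -> `|f x - f y| < e.
Proof.
rewrite subspace_continuousP; split=> H x.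
  move=> x01 e e0; have /= := H x; rewrite in_itv /= => /(_ x01)/cvgrPdist_lt/(_ e e0).
  rewrite /prop_near1 /= /nbhs /= /within /= => -[d d0 Hd]; exists d => // y y01 lt_d.
  by apply: Hd => //=; rewrite in_itv.
rewrite /= in_itv /= => x01; apply/cvgrPdist_lt => e /(H x x01)[d d0 Hd].
exists d => // y /= lt_d; rewrite in_itv /= => y01; exact: Hd.
Qed.

(** In adjacent cylinders the limits are compared through the values at [s 0 1^i] and [s 1 0^i] for
    a large [i]: two errors come from [HD] and one from [dyad]. *)
Lemma dyadic_agree_limword w w' e D : dyadic_agree ->
    (forall u v v', size u = D -> `|g (u ++ v) - g (u ++ v')| <= e) -> 0 < e ->
    pref D w = pref D w' \/
    (exists s j, pref D w = s ++ false :: nseq j true /\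
                 pref D w' = s ++ true :: nseq j false) ->
  `|limword g w - limword g w'| <= e + e + e.
Proof.
move=> dyad HD e0 [E|[s [j [E1 E2]]]].
  have := limword_close w [::] ucg HD; have := limword_close w' [::] ucg HD.
  rewrite -E; set a := g _; rewrite !ler_norml; lra.
have [K /(_ (j + K)%N (leq_addl _ _))] := dyad s _ e0.
have := limword_close w (nseq K true) ucg HD.
have := limword_close w' (nseq K false) ucg HD.
rewrite E1 E2 -!catA /= -!nseqD.
set a := g _; set b := g _; rewrite !ler_norml; lra.
Qed.

Lemma dyadic_agree_continuous : dyadic_agree -> {within `[0, 1[, continuous hat}.
Proof.
move=> dyad; apply/within_continuousP => x x01 e e0.
have e40 : 0 < e / 4 by rewrite divr_gt0.
have [D HD] := ucg e40; exists (2 ^- D) => [|y y01 lt_xy]; first exact: exp2N_gt0.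
have [Ox Ex] := bin_spec x01; have [Oy Ey] := bin_spec y01.
have [le_xy|/ltW le_yx] := leP x y.
  apply: (@le_lt_trans _ _ (e / 4 + e / 4 + e / 4)); last by lra.
  apply: (dyadic_agree_limword dyad HD e40); apply: (@num_close R) => //; rewrite Ex Ey //.
  by apply: le_lt_trans lt_xy; rewrite distrC ler_norm.
rewrite distrC; apply: (@le_lt_trans _ _ (e / 4 + e / 4 + e / 4)); last by lra.
apply: (dyadic_agree_limword dyad HD e40); apply: (@num_close R) => //; rewrite Ex Ey //.
by apply: le_lt_trans lt_xy; rewrite ler_norm.
Qed.

Lemma natval_cat_nseq s j :
  natval (s ++ true :: nseq j false) = (natval (s ++ false :: nseq j true)).+1.
Proof.
elim: j => [|j IHj]; first by rewrite !cats1 !natval_rcons.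
rewrite -addn1 !nseqD -!cat_cons !catA !cats1 !natval_rcons IHj; lia.
Qed.

(** The word [s 0 1 1 1 ...] is outside [Omega]. It is replaced by [s 0 1^j 0 0 0 ...], whose number
    tends to that of [s 1 0 0 0 ...] as [j] grows. *)
Lemma continuous_dyadic_agree : {within `[0, 1[, continuous hat} -> dyadic_agree.
Proof.
move=> /within_continuousP cont s e e0.
have e40 : 0 < e / 4 by rewrite divr_gt0.
pose w j := cat_stream (s ++ false :: nseq j true) (fun=> false).
pose w' := cat_stream (s ++ [:: true]) (fun=> false).
have Ow j : Omega (w j) by exact: Omega_cat_stream.
have Ow' : Omega w' by exact: Omega_cat_stream.
have [d d0 Hd] := cont _ (num_itv R Ow') _ e40.
have [J HJ] := exp2N_small d0; have [D HD] := ucg e40.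
(* The part [J] brings the two numbers within [d]; the part [D] makes the prefixes long enough for
   [HD]. *)
pose j := (J + D)%N; pose k := (size s + 1 + j)%N.
have sizew : k = size (s ++ false :: nseq j true).
  by rewrite size_cat /= size_nseq /k addn1 addnS.
have prefw : pref k (w j) = s ++ false :: nseq j true.
  by rewrite sizew pref_size_cat_stream.
have prefw' : pref k w' = s ++ true :: nseq j false.
  have -> : k = (size (s ++ [:: true]) + j)%N by rewrite size_cat.
  by rewrite pref_cat_stream pref_cst -catA.
have lt_d : `|num R w' - num R (w j)| < d.
  have lt_k : 2 ^- (size s + j) < d by apply: HJ; rewrite /j; lia.
  have half_k : 2 ^- k = 2 ^- (size s + j) / 2 :> R.
    by rewrite /k addn1 addSn exp2N_half.
  (* The dyadic intervals of [w j] and [w'] are adjacent, so the numbers differ by at most twice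
     [2 ^- k]. *)
  have E : num_lo R w' k = num_hi R (w j) k.
    by rewrite /num_lo /num_hi prefw prefw' natval_cat_nseq.
  have := num_le R w' k; have := num_ge R w' k.
  have := num_le R (w j) k; have := num_ge R (w j) k.
  rewrite !num_hiE half_k ltr_norml in E *. lra.
have := Hd _ (num_itv R (Ow j)) lt_d; rewrite /hat !bin_num // => lt_e.
exists j => i le_ji.
have le_Dk : (D <= k)%N by rewrite /k /j; lia.
have HDk : forall u v v', size u = k -> `|g (u ++ v) - g (u ++ v')| <= e / 4.
  move=> u v v' size_u; rewrite -(cat_take_drop D u) -!catA; apply: HD.
  by rewrite size_takel // size_u.
have := limword_close (w j) (nseq (i - j) true) ucg HDk.
have := limword_close w' (nseq (i - j) false) ucg HDk.
rewrite prefw prefw' -!catA /= -!nseqD subnKC //.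
move: lt_e; set a := g _; set b := g _; rewrite !ler_norml ltr_norml; lra.
Qed.

End HatFunction.

(** * Continuity of automata in terms of finite words *)

Section EverywhereContinuous.
Variables (R : realType) (A : wfa R bool).

Definition wfa_word (v : seq bool) : R :=
  (init A *m mxword (trans A) v *m final A) ord0 ord0.

Lemma mxword_nil (T : Type) n (B : T -> 'M[R]_n) : mxword B [::] = 1%:M.
Proof. by rewrite /mxword big_nil. Qed.

Lemma mxword_seq1 (T : Type) n (B : T -> 'M[R]_n) a : mxword B [:: a] = B a.
Proof. by rewrite /mxword big_cons big_nil mulmx1. Qed.

Lemma mxword_cons (T : Type) n (B : T -> 'M[R]_n) a v :
  mxword B (a :: v) = B a *m mxword B v.
Proof. by rewrite /mxword big_cons. Qed.

Lemma mxword_cat (T : Type) n (B : T -> 'M[R]_n) u v :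
  mxword B (u ++ v) = mxword B u *m mxword B v.
Proof.
elim: u => [|a u IHu] /=; first by rewrite mxword_nil mul1mx.
by rewrite !mxword_cons IHu mulmxA.
Qed.

Lemma mxword_rcons (T : Type) n (B : T -> 'M[R]_n) v a :
  mxword B (rcons v a) = mxword B v *m B a.
Proof. by rewrite -cats1 mxword_cat mxword_seq1. Qed.

Lemma wfa_word_average : average_preserving A -> forall v,
  wfa_word (rcons v false) + wfa_word (rcons v true) = 2 * wfa_word v.
Proof.
move=> apA v; have := congr1 (fun X => (init A *m mxword (trans A) v *m X) ord0 ord0) apA.
rewrite big_bool mulmxDr -scalemxAr card_bool !mulmxA [LHS]mxE [RHS]mxE.
by rewrite /wfa_word !mxword_rcons !mulmxA addrC.
Qed.

(** Both continuity conditions become conditions on the values at finite words; both reductions work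
    with this form. *)
Lemma everywhere_continuousP : average_preserving A ->
  everywhere_continuous A <-> unif_cauchy wfa_word /\ dyadic_agree wfa_word.
Proof.
move=> apA; split=> [[[def cont] [_ hat_cont]]|[ucg dyad]].
  have ucg : unif_cauchy wfa_word.
    by apply: continuous_unif_cauchy => //; exact: wfa_word_average.
  by split=> //; exact: continuous_dyadic_agree.
have def w : omega_defined A w by exact: (@unif_cauchy_cvg _ _ wfa_word w ucg).
split; split=> //; first exact: (@unif_cauchy_continuous _ _ wfa_word ucg).
  by move=> x _; exact: def.
exact: (@dyadic_agree_continuous _ wfa_word ucg dyad).
Qed.

End EverywhereContinuous.

(** * Stability of matrix products *)

Section EntryNorm.
Variable R : realType.

(** This norm is submultiplicative for matrices of all shapes and dominates every entry. *)
Definition l1norm m n (A : 'M[R]_(m, n)) : R := \sum_i \sum_j `|A i j|.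

Lemma l1norm_ge0 m n (A : 'M[R]_(m, n)) : 0 <= l1norm A.
Proof. by apply: sumr_ge0 => i _; apply: sumr_ge0 => j _. Qed.

Lemma l1norm_entry m n (A : 'M[R]_(m, n)) i j : `|A i j| <= l1norm A.
Proof.
rewrite /l1norm (bigD1 i) //= (bigD1 j) //= -addrA lerDl addr_ge0 //.
  by apply: sumr_ge0.
by apply: sumr_ge0 => k _; apply: sumr_ge0.
Qed.

Lemma l1norm0 m n : l1norm (0 : 'M[R]_(m, n)) = 0.
Proof. by rewrite /l1norm big1 // => i _; rewrite big1 // => j _; rewrite mxE normr0. Qed.

Lemma l1normN m n (A : 'M[R]_(m, n)) : l1norm (- A) = l1norm A.
Proof. by apply: eq_bigr => i _; apply: eq_bigr => j _; rewrite mxE normrN. Qed.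

Lemma l1normD m n (A B : 'M[R]_(m, n)) : l1norm (A + B) <= l1norm A + l1norm B.
Proof.
rewrite /l1norm -big_split /=; apply: ler_sum => i _; rewrite -big_split /=.
by apply: ler_sum => j _; rewrite mxE ler_normD.
Qed.

Lemma l1normM m n p (A : 'M[R]_(m, n)) (B : 'M[R]_(n, p)) :
  l1norm (A *m B) <= l1norm A * l1norm B.
Proof.
rewrite /l1norm mulr_suml; apply: ler_sum => i _; rewrite mulr_suml.
apply: (@le_trans _ _ (\sum_j \sum_k `|A i k| * `|B k j|)).
  apply: ler_sum => j _; rewrite mxE (le_trans (ler_norm_sum _ _ _)) //.
  by apply: ler_sum => k _; rewrite normrM.
rewrite exchange_big /=; apply: ler_sum => k _; rewrite -mulr_sumr ler_wpM2l //.
rewrite [leRHS](bigD1 k) //= lerDl; apply: sumr_ge0 => l _; exact: sumr_ge0.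
Qed.

Lemma l1norm_le m n (A : 'M[R]_(m, n)) e :
  (forall i j, `|A i j| <= e) -> l1norm A <= (m * n)%:R * e.
Proof.
move=> H; rewrite /l1norm -[m in X in _ <= X]card_ord -[n in X in _ <= X]card_ord.
rewrite natrM -mulrA mulr_natl -sumr_const; apply: ler_sum => i _.
by rewrite mulr_natl -sumr_const; apply: ler_sum => j _.
Qed.

Lemma cvg_mx0P m n (M : nat -> 'M[R]_(m, n)) :
  M @ \oo --> (0 : 'M[R]_(m, n)) <-> tends0 (fun k => l1norm (M k)).
Proof.
split=> [/cvg_ballP H e e0|H].
  (* The successor keeps the divisor positive for empty matrices. *)
  have e'0 : 0 < e / (m * n).+1%:R by rewrite divr_gt0.
  have [K _ HK] := H _ e'0; exists K => k /HK [_ /= Hk].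
  rewrite ger0_norm ?l1norm_ge0 //; apply: (@le_trans _ _ ((m * n)%:R * (e / (m * n).+1%:R))).
    apply: l1norm_le => i j; have := Hk i j.
    by rewrite /ball /= mxE sub0r normrN => /ltW.
  rewrite mulrA ler_pdivrMr ?ltr0n // mulrC ler_wpM2l ?ler_nat //; exact: ltW.
apply/cvg_ballP => e e0; have [K HK] := H _ (divr_gt0 e0 (ltr0n R 2)).
exists K => // k /= /HK; rewrite ger0_norm ?l1norm_ge0 // => lt_e; split=> // i j.
rewrite /ball /= mxE sub0r normrN; apply: le_lt_trans (l1norm_entry _ i j) _.
by apply: le_lt_trans lt_e _; rewrite ltr_pdivrMr // ltr_pMr ?ltr1n.
Qed.

End EntryNorm.

Section WordLimits.
Variables (R : realType) (T : Type).

Definition vanishing m n (M : seq T -> 'M[R]_(m, n)) : Prop :=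
  forall e : R, 0 < e ->
    exists D, forall v, (D <= size v)%N -> l1norm (M v) <= e.

Lemma vanishing_ext m n (M M' : seq T -> 'M[R]_(m, n)) :
  M =1 M' -> vanishing M -> vanishing M'.
Proof. by move=> E H e /H[D HD]; exists D => v; rewrite -E; exact: HD. Qed.

Lemma vanishing0 m n : vanishing (fun=> 0 : 'M[R]_(m, n)).
Proof. by move=> e /ltW; exists 0%N => v _; rewrite l1norm0. Qed.

Lemma vanishingD m n (M M' : seq T -> 'M[R]_(m, n)) :
  vanishing M -> vanishing M' -> vanishing (fun v => M v + M' v).
Proof.
move=> H H' e e0; have e20 := divr_gt0 e0 (ltr0n R 2).
have [D HD] := H _ e20; have [D' HD'] := H' _ e20.
exists (maxn D D') => v; rewrite geq_max => /andP[/HD le1 /HD' le2].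
by apply: le_trans (l1normD _ _) _; lra.
Qed.

Lemma vanishingM m n p q (B : 'M[R]_(p, m)) (C : 'M[R]_(n, q))
    (M : seq T -> 'M[R]_(m, n)) :
  vanishing M -> vanishing (fun v => B *m M v *m C).
Proof.
move=> H e e0; pose c := l1norm B * l1norm C + 1.
have c0 : 0 < c by rewrite ltr_wpDl // mulr_ge0 // l1norm_ge0.
have [D HD] := H _ (divr_gt0 e0 c0); exists D => v /HD le_e.
apply: le_trans (l1normM _ _) _.
apply: le_trans (ler_wpM2r (l1norm_ge0 _) (l1normM _ _)) _.
rewrite mulrAC; apply: (@le_trans _ _ (c * l1norm (M v))).
  by rewrite ler_wpM2r ?l1norm_ge0 // lerDl.
by move: le_e; rewrite ler_pdivlMr // mulrC.
Qed.

Lemma vanishingMl m n p (B : 'M[R]_(p, m)) (M : seq T -> 'M[R]_(m, n)) :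
  vanishing M -> vanishing (fun v => B *m M v).
Proof. by move/(vanishingM B 1%:M); apply: vanishing_ext => v; rewrite mulmx1. Qed.

Lemma vanishingMr m n q (C : 'M[R]_(n, q)) (M : seq T -> 'M[R]_(m, n)) :
  vanishing M -> vanishing (fun v => M v *m C).
Proof. by move/(vanishingM 1%:M C); apply: vanishing_ext => v; rewrite mul1mx. Qed.

Lemma vanishing_cons m n (M : seq T -> 'M[R]_(m, n)) a :
  vanishing M -> vanishing (fun v => M (a :: v)).
Proof. by move=> H e /H[D HD]; exists D => v le_D; apply: HD; rewrite leqW. Qed.

End WordLimits.

Section Stability.
Variables (R : realType) (T : finType) (n : nat) (B : T -> 'M[R]_n).

Lemma mxword_bounded K :
  exists2 C : R, 0 <= C & forall v, (size v <= K)%N -> l1norm (mxword B v) <= C.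
Proof.
pose c := \sum_a l1norm (B a); have c0 : 0 <= c by apply: sumr_ge0 => a _; exact: l1norm_ge0.
elim: K => [|K [C C0 HC]].
  exists (l1norm (1%:M : 'M[R]_n)); first exact: l1norm_ge0.
  by case=> // _; rewrite mxword_nil.
exists (C + c * C) => [|[_|a v]]; first by rewrite addr_ge0 // mulr_ge0.
  by apply: le_trans (HC [::] _) _; rewrite // lerDl mulr_ge0.
move=> /HC le_C; rewrite mxword_cons (le_trans (l1normM _ _)) //.
apply: (@le_trans _ _ (c * C)); last by rewrite lerDr.
rewrite ler_pM ?l1norm_ge0 // /c (bigD1 a) //= lerDl.
by apply: sumr_ge0 => ? _; exact: l1norm_ge0.
Qed.

(** By [fan], every word of length [D] has a nonempty prefix whose product has norm at most 1/2.
    Peeling off such prefixes bounds all products, and then makes them decay geometrically with the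
    length. *)
Lemma stableP : stable B <-> vanishing (mxword B).
Proof.
split=> [stB|vanB w]; last first.
  apply/cvg_mx0P => e /vanB[D HD]; exists D => k le_Dk.
  by rewrite ger0_norm ?l1norm_ge0 //; apply: HD; rewrite size_pref.
have [D HD] : exists D, forall v, size v = D -> exists u1 u2,
    [/\ v = u1 ++ u2, (0 < size u1)%N & l1norm (mxword B u1) <= 1 / 2].
  (* Having a nonempty prefix with small product is inherited by extensions, unlike smallness of the
     whole product. *)
  apply: fan => [u v [u1 [u2 [-> u10 le_u1]]]|w].
    by exists u1, (u2 ++ v); rewrite catA.
  have /cvg_mx0P/(_ (1 / 2))[|K HK] := stB w; first by rewrite divr_gt0.
  exists K.+1, (pref K.+1 w), [::]; rewrite cats0 size_pref; split=> //.
  by have := HK _ (leqnSn K); rewrite ger0_norm ?l1norm_ge0.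
have split_word v : (D <= size v)%N -> exists u1 u2,
    [/\ v = u1 ++ u2, (0 < size u1)%N, (size u1 <= D)%N
      & l1norm (mxword B v) <= l1norm (mxword B u2) / 2].
  move=> le_Dv; have [|u1 [u2 [E u10 le_u1]]] := HD (take D v).
    by rewrite size_takel.
  exists u1, (u2 ++ drop D v); rewrite catA -E cat_take_drop; split=> //.
    by have := congr1 size E; rewrite size_takel // size_cat => ->; rewrite leq_addr.
  rewrite -[v in X in X <= _](cat_take_drop D) E -catA mxword_cat.
  apply: le_trans (l1normM _ _) _; rewrite mulrC ler_wpM2l ?l1norm_ge0 //.
  by rewrite -div1r.
have [C C0 HC] := mxword_bounded D.
have bnd v : l1norm (mxword B v) <= C.
  have [k] := ubnP (size v); elim: k v => // k IHk v; rewrite ltnS => le_vk.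
  have [/HC//|/ltnW/split_word[u1 [u2 [E u10 _ le_v]]]] := leqP (size v) D.
  apply: le_trans le_v _; have : l1norm (mxword B u2) <= C.
    by apply: IHk; move: le_vk; rewrite E size_cat; lia.
  lra.
(* A peeled prefix has at most [D] letters, so a word of length [j * D] admits [j] halvings. *)
have decay j v : (j * D <= size v)%N -> l1norm (mxword B v) <= C * 2 ^- j.
  elim: j v => [|j IHj] v le_v; first by rewrite expr0 invr1 mulr1.
  have [|u1 [u2 [E _ le_u1 le_B]]] := split_word v; first by lia.
  apply: le_trans le_B _; rewrite exp2N_half mulrA ler_pM2r ?invr_gt0 //.
  by apply: IHj; move: le_v; rewrite E size_cat mulSn; lia.
move=> e e0; have C10 : 0 < C + 1 by rewrite ltr_wpDl.
have [j /(_ j (leqnn j)) ltj] := exp2N_small (divr_gt0 e0 C10).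
exists (j * D)%N => v /decay le_v; apply: le_trans le_v _.
apply: (@le_trans _ _ ((C + 1) * 2 ^- j)).
  by rewrite ler_pM2r ?exp2N_gt0 // lerDl.
by rewrite mulrC -ler_pdivlMr // ltW.
Qed.

Variables (r : 'rV[R]_n) (c : T -> 'cV[R]_n) (g : seq T -> R).
Hypothesis g_step :
  forall v a, g (rcons v a) = g v + (r *m mxword B v *m c a) ord0 ord0.
Hypothesis vanB : vanishing (mxword B).

(** [tail v] is the sum of [B_u c_a] over all factorizations [v = u ++ a :: u']. *)
Let tail (v : seq T) : 'cV[R]_n := foldr (fun a p => c a + B a *m p) 0 v.

Lemma tail_cat u v : tail (u ++ v) = tail u + mxword B u *m tail v.
Proof.
elim: u => [|a u IHu]; first by rewrite mxword_nil mul1mx add0r.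
by rewrite /= IHu mulmxDr addrA mulmxA mxword_cons.
Qed.

Lemma g_cat u v : g (u ++ v) = g u + (r *m mxword B u *m tail v) ord0 ord0.
Proof.
elim/last_ind: v => [|v a IHv]; first by rewrite cats0 mulmx0 mxE addr0.
rewrite -rcons_cat g_step IHv -cats1 tail_cat /= mulmx0 addr0 -addrA; congr (_ + _).
by rewrite mulmxDr [RHS]mxE mxword_cat !mulmxA.
Qed.

(** Words are cut into blocks of length [D]: a block contributes at most [C1], and its product at
    least halves what the rest contributes, so [C1 + C1] is a bound. *)
Lemma tail_bounded : exists2 C : R, 0 <= C & forall v, l1norm (tail v) <= C.
Proof.
have [D0 HD0] := vanB (divr_gt0 (ltr01 : 0 < 1 :> R) (ltr0n R 2)).
(* [D] is positive, so cutting off a block shortens the word. *)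
pose D := D0.+1; have [C C0 HC] := mxword_bounded D.
pose cc := \sum_a l1norm (c a).
have cc0 : 0 <= cc by apply: sumr_ge0 => a _; exact: l1norm_ge0.
have cc_ge a : l1norm (c a) <= cc.
  by rewrite /cc (bigD1 a) //= lerDl; apply: sumr_ge0 => ? _; exact: l1norm_ge0.
pose C1 := D%:R * (C * cc); have C10 : 0 <= C1 by rewrite !mulr_ge0.
have short v : (size v <= D)%N -> l1norm (tail v) <= (size v)%:R * (C * cc).
  elim/last_ind: v => [|v a IHv]; first by rewrite l1norm0 mul0r.
  rewrite size_rcons => lt_v; rewrite -natr1 mulrDl mul1r -cats1 tail_cat /= mulmx0 addr0.
  apply: le_trans (l1normD _ _) _; rewrite lerD ?IHv ?(ltnW lt_v) //.
  by apply: le_trans (l1normM _ _) _; rewrite ler_pM ?l1norm_ge0 // HC // ltnW.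
have {}short v : (size v <= D)%N -> l1norm (tail v) <= C1.
  by move=> le_v; apply: le_trans (short v le_v) _; rewrite ler_wpM2r ?mulr_ge0 ?ler_nat.
exists (C1 + C1) => [|v]; first by rewrite addr_ge0.
have [k] := ubnP (size v); elim: k v => // k IHk v; rewrite ltnS => le_vk.
have [/short le_v|lt_v] := leqP (size v) D; first by rewrite (le_trans le_v) // lerDl.
rewrite -(cat_take_drop D v) tail_cat; apply: le_trans (l1normD _ _) _.
have size_u : size (take D v) = D by rewrite size_takel // ltnW.
have le_u : l1norm (tail (take D v)) <= C1 by apply: short; rewrite size_u.
have le_v' : l1norm (tail (drop D v)) <= C1 + C1.
  by apply: IHk; rewrite size_drop; apply: leq_trans le_vk; rewrite ltn_subrL /D; lia.
have le_B : l1norm (mxword B (take D v)) <= 1 / 2 by apply: HD0; rewrite size_u.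
have := l1normM (mxword B (take D v)) (tail (drop D v)).
have := ler_pM (l1norm_ge0 _) (l1norm_ge0 _) le_B le_v'; lra.
Qed.

(** By [g_cat], the values at [u ++ v] and [u ++ v'] differ by [r B_u (tail v - tail v')], where
    [B_u] is small and the tails are bounded. *)
Lemma vanishing_unif_cauchy : unif_cauchy g.
Proof.
move=> e e0; have [C C0 HC] := tail_bounded.
pose d := l1norm r * (C + C) + 1.
have d0 : 0 < d by rewrite ltr_wpDl // mulr_ge0 ?l1norm_ge0 ?addr_ge0.
have [D HD] := vanB (divr_gt0 e0 d0); exists D => u v v' size_u.
rewrite !g_cat opprD addrACA subrr add0r.
have -> : (r *m mxword B u *m tail v) ord0 ord0 - (r *m mxword B u *m tail v') ord0 ord0
    = (r *m (mxword B u *m (tail v - tail v'))) ord0 ord0.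
  by rewrite !mulmxBr !mulmxA !mxE.
apply: le_trans (l1norm_entry _ _ _) _; apply: le_trans (l1normM _ _) _.
have le_u : l1norm (mxword B u) <= e / d by apply: HD; rewrite size_u.
have le_t : l1norm (tail v - tail v') <= C + C.
  by apply: le_trans (l1normD _ _) _; rewrite l1normN lerD.
apply: le_trans (ler_wpM2l (l1norm_ge0 _) (l1normM _ _)) _.
apply: le_trans (ler_wpM2l (l1norm_ge0 _) (ler_pM (l1norm_ge0 _) (l1norm_ge0 _) le_u le_t)) _.
by rewrite mulrCA mulrAC ler_pdivrMr // ler_pM2l // /d lerDl.
Qed.

End Stability.

(** * Compression to the reachable and observable part *)

Section Gram.
Variables (R : realType) (n : nat) (r : 'rV[R]_n) (A : bool -> 'M[R]_n).

(* The sum of [(r A_u)^T (r A_u)] over the words [u] of length less than [k];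
   over an ordered field, its row space is the span of these vectors [r A_u]. *)
Definition gram (k : nat) : 'M[R]_n :=
  iter k (fun G => r^T *m r + (A false)^T *m G *m A false
                            + (A true)^T *m G *m A true) 0.

Lemma gramSE k p (X : 'M[R]_(n, p)) : gram k.+1 *m X = r^T *m (r *m X)
  + (A false)^T *m (gram k *m (A false *m X)) + (A true)^T *m (gram k *m (A true *m X)).
Proof. by rewrite /= !mulmxDl !mulmxA. Qed.

Lemma gram_sym k : (gram k)^T = gram k.
Proof.
elim: k => [|k IHk] /=; first by rewrite trmx0.
by rewrite !linearD /= !trmx_mul !trmxK IHk !mulmxA.
Qed.

Lemma gram_mul0 k p (X : 'M[R]_(n, p)) :
  (forall u, (size u < k)%N -> r *m mxword A u *m X = 0) -> gram k *m X = 0.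
Proof.
elim: k X => [|k IHk] X H; first by rewrite mul0mx.
have H0 : r *m X = 0.
  by have := H [::] isT; rewrite mxword_nil mulmx1.
have Ha a : gram k *m (A a *m X) = 0.
  apply: IHk => u lt_u; have := H (rcons u a); rewrite size_rcons => /(_ lt_u).
  by rewrite mxword_rcons !mulmxA.
by rewrite gramSE H0 !Ha !mulmx0 !addr0.
Qed.

(** The quadratic form of the Gram matrix is the sum of the squares of the numbers [r A_u x], so it
    vanishes only if each of them does. *)
Lemma gram_quad k (x : 'cV[R]_n) : 0 <= (x^T *m (gram k *m x)) ord0 ord0 /\
  ((x^T *m (gram k *m x)) ord0 ord0 = 0 ->
   forall u, (size u < k)%N -> r *m mxword A u *m x = 0).
Proof.
elim: k x => [|k IHk] x; first by rewrite mul0mx mulmx0 mxE; split.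
have -> : (x^T *m (gram k.+1 *m x)) ord0 ord0 = ((r *m x) ord0 ord0) ^+ 2
    + ((A false *m x)^T *m (gram k *m (A false *m x))) ord0 ord0
    + ((A true *m x)^T *m (gram k *m (A true *m x))) ord0 ord0.
  rewrite gramSE !mulmxDr !trmx_mul !mulmxA [LHS]mxE [X in X + _ = _]mxE.
  congr (_ + _ + _); rewrite -[x^T *m r^T]trmx_mul -mulmxA mxE big_ord1 mxE.
  by rewrite expr2.
have [f0 fP] := IHk (A false *m x); have [t0 tP] := IHk (A true *m x).
have rx0 := sqr_ge0 ((r *m x) ord0 ord0); split; first by lra.
move=> E; have Er : (r *m x) ord0 ord0 ^+ 2 = 0 by lra.
have {}fP := fP (ltac:(lra)); have {}tP := tP (ltac:(lra)).
case/lastP => [_|u a].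
  apply/matrixP => i j; rewrite !ord1 mxword_nil mulmx1 [RHS]mxE.
  by apply/eqP; rewrite -sqrf_eq0 Er.
rewrite size_rcons ltnS mxword_rcons => lt_u; rewrite !mulmxA in fP tP *.
by case: a; [have := tP u lt_u | have := fP u lt_u]; rewrite !mulmxA.
Qed.

Lemma gram_ker_lt k p (X : 'M[R]_(n, p)) : gram k *m X = 0 ->
  forall u, (size u < k)%N -> r *m mxword A u *m X = 0.
Proof.
move=> GX u lt_u; apply/matrixP => i j; rewrite [RHS]mxE.
have GXj : gram k *m col j X = 0 by rewrite colE mulmxA GX mul0mx.
have [_ /(_ _ u lt_u)] := gram_quad k (col j X).
rewrite GXj mulmx0 mxE => /(_ erefl) /matrixP /(_ i ord0).
by rewrite colE mulmxA -colE mxE [X in _ = X]mxE.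
Qed.

Lemma gram_ker_le k l p (X : 'M[R]_(n, p)) :
  (k <= l)%N -> gram l *m X = 0 -> gram k *m X = 0.
Proof.
move=> le_kl GX; apply: gram_mul0 => u lt_u.
by apply: (gram_ker_lt GX); exact: leq_trans le_kl.
Qed.

(** The row spaces increase with [k], and their dimension can grow strictly at most [n] times. *)
Lemma gram_stationary : exists2 k, (k <= n)%N & (gram k.+1 <= gram k)%MS.
Proof.
have rank_or k : (exists2 j, (j < k)%N & (gram j.+1 <= gram j)%MS) \/ (k <= \rank (gram k))%N.
  elim: k => [|k [[j lt_jk sub]|IHk]]; first by right.
    by left; exists j => //; exact: ltnW.
  have [sub|nsub] := boolP (gram k.+1 <= gram k)%MS; first by left; exists k.
  right; apply: leq_ltn_trans IHk _; rewrite ltn_neqAle; apply/andP.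
  have sub : (gram k <= gram k.+1)%MS.
    by rewrite submxE; apply/eqP/(gram_ker_le (leqnSn k)); exact: mulmx_coker.
  split; last exact: mxrankS.
  by apply: contraNneq nsub => E; rewrite -(geq_leqif (mxrank_leqif_sup sub)) E.
by have [//|] := rank_or n.+1; rewrite leqNgt ltnS rank_leq_row.
Qed.

(** Once the row spaces are stationary, longer words impose no new conditions; this happens at some
    [k <= n]. *)
Lemma gram_ker p (X : 'M[R]_(n, p)) :
  gram n *m X = 0 -> forall u, r *m mxword A u *m X = 0.
Proof.
move=> GX u; have [k le_kn /submxP[Y EY]] := gram_stationary.
(* Stationarity at [k] propagates: for a word one letter longer, the last letter is moved onto
   [Z]. *)
have kerS m q (Z : 'M[R]_(n, q)) : gram (k + m) *m Z = 0 -> gram (k + m.+1) *m Z = 0.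
  elim: m q Z => [|m IHm] q Z GZ; first by rewrite addn1 EY -mulmxA -[k]addn0 GZ mulmx0.
  apply: gram_mul0 => v; rewrite addnS ltnS; case/lastP: v => [|v a].
    by move=> _; apply: (gram_ker_lt GZ); rewrite addnS.
  rewrite size_rcons mxword_rcons mulmxA -mulmxA => lt_v.
  have: gram (k + m.+1) *m (A a *m Z) = 0.
    apply: IHm; apply: gram_mul0 => v' lt_v'; rewrite mulmxA -[_ *m _ *m A a]mulmxA.
    by rewrite -mxword_rcons; apply: (gram_ker_lt GZ); rewrite size_rcons addnS ltnS.
  by move/gram_ker_lt; apply.
have ker_add m : gram (k + m) *m X = 0.
  elim: m => [|m IHm]; last exact: kerS.
  by rewrite addn0; exact: gram_ker_le GX.
by apply: (gram_ker_lt (ker_add (size u).+1)); rewrite addnS ltnS leq_addl.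
Qed.

(** Membership in the row space is tested on [cokermx], which the Gram matrix kills and hence every
    [r A_u] kills. *)
Lemma gram_row u : exists y : 'rV[R]_n, r *m mxword A u = y *m gram n.
Proof.
by apply/submxP; rewrite submxE; apply/eqP/gram_ker; exact: mulmx_coker.
Qed.

Lemma gram_invariant a : exists X, gram n *m A a = X *m gram n.
Proof.
apply/submxP; rewrite submxE -mulmxA; apply/eqP/gram_mul0 => u _.
rewrite mulmxA -[_ *m _ *m A a]mulmxA -mxword_rcons.
by apply: gram_ker; exact: mulmx_coker.
Qed.

End Gram.

(** * The compressed pair of matrices *)

Section Reduction.
Variables (R : realType) (n : nat) (r : 'rV[R]_n) (d : 'cV[R]_n) (A : bool -> 'M[R]_n).

Let G := gram r A n.
(** The same construction for the transposed data; as [K] is symmetric, its columns span the vectors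
    [A_u d]. *)
Let K := gram d^T (fun a => (A a)^T) n.

Lemma gram_col : exists z : 'cV[R]_n, d = K *m z.
Proof.
have [y] := gram_row d^T (fun a => (A a)^T) [::]; rewrite mxword_nil mulmx1.
by move/(congr1 trmx); rewrite trmxK trmx_mul gram_sym; exists y^T.
Qed.

Lemma gram_col_invariant a : exists X, A a *m K = K *m X.
Proof.
have [X] := gram_invariant d^T (fun a => (A a)^T) a.
by move/(congr1 trmx); rewrite !trmx_mul trmxK gram_sym; exists X^T.
Qed.

Lemma gram_word v : exists X, G *m mxword A v = X *m G.
Proof.
elim: v => [|a v [X EX]]; first by exists 1%:M; rewrite mxword_nil mul1mx mulmx1.
have [Y EY] := gram_invariant r A a; exists (Y *m X).
by rewrite mxword_cons mulmxA EY -!mulmxA EX.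
Qed.

Lemma gram_col_word v : exists X, mxword A v *m K = K *m X.
Proof.
elim: v => [|a v [X EX]]; first by exists 1%:M; rewrite mxword_nil mul1mx mulmx1.
have [Y EY] := gram_col_invariant a; exists (Y *m X).
by rewrite mxword_cons -mulmxA EX !mulmxA EY.
Qed.

(** Unfolding both Gram matrices expresses [G A_w K] by finitely many numbers [r A_u A_w A_v d],
    each belonging to a word at least as long as [w]. *)
Lemma vanishing_gram :
  vanishing (fun w => r *m mxword A w *m d) -> vanishing (fun w => G *m mxword A w *m K).
Proof.
move=> van.
(* The suffix [v] makes room for the letters that [K] adds on the right in [vanK]. *)
have vanG k v : vanishing (fun w => gram r A k *m (mxword A (w ++ v) *m d)).
  elim: k v => [|k IHk] v.
    by move: (@vanishing0 R bool n 1); apply: vanishing_ext => w; rewrite mul0mx.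
  suff: vanishing (fun w => r^T *m (r *m mxword A (w ++ v) *m d)
    + (A false)^T *m (gram r A k *m (mxword A ((false :: w) ++ v) *m d))
    + (A true)^T *m (gram r A k *m (mxword A ((true :: w) ++ v) *m d))).
    by apply: vanishing_ext => w; rewrite gramSE !cat_cons !mxword_cons !mulmxA.
  apply: vanishingD; first apply: vanishingD; apply: vanishingMl.
  - by move=> e /van[D HD]; exists D => w le_D; apply: HD; rewrite size_cat; lia.
  - exact: (vanishing_cons (M := fun w => gram r A k *m (mxword A (w ++ v) *m d)) false (IHk v)).
  - exact: (vanishing_cons (M := fun w => gram r A k *m (mxword A (w ++ v) *m d)) true (IHk v)).
have vanK k v : vanishing (fun w => G *m mxword A (w ++ v) *m gram d^T (fun a => (A a)^T) k).
  elim: k v => [|k IHk] v.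
    by move: (@vanishing0 R bool n n); apply: vanishing_ext => w; rewrite mulmx0.
  suff: vanishing (fun w => (G *m (mxword A (w ++ v) *m d)) *m d^T
    + (G *m mxword A (w ++ rcons v false) *m gram d^T (fun a => (A a)^T) k) *m (A false)^T
    + (G *m mxword A (w ++ rcons v true) *m gram d^T (fun a => (A a)^T) k) *m (A true)^T).
    by apply: vanishing_ext => w; rewrite /= !trmxK -!rcons_cat !mxword_rcons !mulmxDr !mulmxA.
  apply: vanishingD; first apply: vanishingD; apply: vanishingMr; [exact: vanG|exact: IHk|exact: IHk].
by move: (vanK n [::]); apply: vanishing_ext => w; rewrite cats0.
Qed.

Variable Z : 'M[R]_n.
Hypothesis ginvZ : G *m K *m Z *m (G *m K) = G *m K.

(** By [ginvZ], the factor [K Z G] acts as the identity between [G] and [K]. Each letter is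
    compressed by it on both sides. *)
Definition minimal_trans (a : bool) : 'M[R]_n := K *m Z *m G *m A a *m (K *m Z *m G).

(** Invariance gives [G A_u = X G] and [A_v K = K Y], which reduces the claim to [ginvZ] between [X]
    and [Y]. *)
Lemma sandwich u v :
  G *m mxword A u *m K *m Z *m (G *m mxword A v *m K) = G *m mxword A (u ++ v) *m K.
Proof.
have [X EX] := gram_word u; have [Y EY] := gram_col_word v.
have -> : G *m mxword A (u ++ v) *m K = X *m (G *m K) *m Y.
  by rewrite mxword_cat (mulmxA G) EX -!mulmxA EY.
have -> : G *m mxword A v *m K = G *m K *m Y by rewrite -mulmxA EY mulmxA.
by rewrite EX -{2}ginvZ !mulmxA.
Qed.

(** The inner copies of [K Z G] are absorbed by [sandwich] and only the outer ones remain. For the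
    empty word the product is the identity, without outer factors. *)
Lemma minimal_word v : v != [::] ->
  mxword minimal_trans v = K *m Z *m (G *m mxword A v *m K) *m (Z *m G).
Proof.
case/lastP: v => // v a _; elim: v => [|b v IHv].
  by rewrite /= !mxword_seq1 /minimal_trans !mulmxA.
rewrite rcons_cons !mxword_cons IHv -[A b *m _]mxword_cons.
have := sandwich [:: b] (rcons v a); rewrite cat1s => <-.
have := sandwich [::] (rcons v a); rewrite cat0s mxword_nil mulmx1 => {2}<-.
by rewrite mxword_seq1 /minimal_trans !mulmxA.
Qed.

Lemma minimal_gram v : G *m mxword minimal_trans v *m K = G *m mxword A v *m K.
Proof.
have [->|v0] := eqVneq v [::]; first by rewrite !mxword_nil.
have := sandwich v [::]; rewrite cats0 mxword_nil mulmx1 => <-.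
have := sandwich [::] v; rewrite cat0s mxword_nil mulmx1 => {1}<-.
by rewrite minimal_word // !mulmxA.
Qed.

(** Forwards, [r = y G] and [d = K z] turn [r A_w d] into a fixed linear image of the compressed
    product. Backwards, that product is a fixed linear image of [G A_w K]. *)
Lemma stable_minimal_trans :
  stable minimal_trans <-> vanishing (fun w => r *m mxword A w *m d).
Proof.
have [y Ey] := gram_row r A [::]; rewrite mxword_nil mulmx1 in Ey.
have [z Ez] := gram_col.
rewrite stableP; split=> [vanB|/vanishing_gram vanG].
  have := vanishingM (y *m G) (K *m z) vanB; apply: vanishing_ext => v.
  transitivity (y *m (G *m mxword minimal_trans v *m K) *m z); first by rewrite !mulmxA.
  transitivity (y *m G *m mxword A v *m (K *m z)); last by rewrite -Ey -Ez.
  by rewrite minimal_gram !mulmxA.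
have := vanishingM (K *m Z) (Z *m G) vanG => {}vanG e /vanG[D HD].
exists D.+1 => v lt_v; rewrite minimal_word; first by apply: HD; exact: ltnW.
by case: v lt_v.
Qed.

End Reduction.

(** * Sums along constant words *)

Section OrbitSums.
Variables (R : realType) (n : nat) (r : 'rV[R]_n) (d : 'cV[R]_n) (A : bool -> 'M[R]_n).

Let G := gram r A n.
Let K := gram d^T (fun a => (A a)^T) n.

(** This is the partial sum [d + A_a d + ... + A_a^(k-1) d]. *)
Definition orbit_sum (a : bool) (k : nat) : 'cV[R]_n := iter k (fun s => d + A a *m s) 0.

Lemma orbit_sum_col a k : exists c : 'cV[R]_n, orbit_sum a k = K *m c.
Proof.
have [z Ez] := gram_col d A; have [X EX] := gram_col_invariant d A a.
elim: k => [|k [c /= ->]]; first by exists 0; rewrite mulmx0.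
by exists (z + X *m c); rewrite {1}Ez mulmxDr !mulmxA EX.
Qed.

Lemma orbit_sum_telescope a k :
  orbit_sum a k - A a *m orbit_sum a k = d - mxword A (nseq k a) *m d.
Proof.
elim: k => [|k IHk]; first by rewrite mulmx0 mxword_nil mul1mx !subrr.
rewrite [nseq k.+1 a]/= mxword_cons [orbit_sum a k.+1]/= -mulmxA.
have := congr1 (mulmx (A a)) IHk; rewrite !mulmxBr => E.
by rewrite mulmxDr opprD addrACA E addrA subrK.
Qed.

Hypothesis vanG : vanishing (fun w => G *m mxword A w *m K).
Variable Z : bool -> 'M[R]_n.

Let M (a : bool) : 'M[R]_n := G *m (1%:M - A a) *m K.
Hypothesis ginvZ : forall a, M a *m Z a *m M a = M a.

(* Stands for the sum of the series [d + A a d + (A a)^2 d + ...], modulo the kernel of [G]. *)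
Definition orbit_limit (a : bool) : 'cV[R]_n := K *m (Z a *m (G *m d)).

(** By telescoping, [G d] lies in the range of [M a] up to [G A_a^k d], and [M a Z_a] is the
    identity on that range. The defect is thus an image of [G A_a^k K], which tends to 0, while it
    does not depend on [k]. *)
Lemma orbit_limit_eq a : G *m ((1%:M - A a) *m orbit_limit a) = G *m d.
Proof.
have [z Ez] := gram_col d A.
have eqk k : M a *m Z a *m (G *m d) - G *m d
    = (M a *m Z a - 1%:M) *m (G *m mxword A (nseq k a) *m K) *m z.
  have [c Ec] := orbit_sum_col a k.
  have E : G *m d = M a *m c + G *m mxword A (nseq k a) *m K *m z.
    rewrite /M -!mulmxA -Ec -Ez -mulmxDr mulmxBl mul1mx orbit_sum_telescope.
    by rewrite addrNK.
  rewrite {1 2}E mulmxDr (mulmxA _ (M a) c) ginvZ opprD addrACA subrr add0r.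
  by rewrite -(mulmxA (M a *m Z a - 1%:M)) mulmxBl mul1mx.
apply/eqP; rewrite -subr_eq0; apply/eqP/matrixP => i j; rewrite [RHS]mxE.
have -> : G *m ((1%:M - A a) *m orbit_limit a) - G *m d
    = M a *m Z a *m (G *m d) - G *m d by rewrite /M /orbit_limit !mulmxA.
apply/eqP; rewrite -normr_le0; apply: ler_small => e /(vanishingM (M a *m Z a - 1%:M) z vanG).
case=> D HD; rewrite add0r (eqk D) (le_trans (l1norm_entry _ _ _)) //.
by apply: HD; rewrite size_nseq.
Qed.

Lemma orbit_sum_limit b a k : G *m (A b *m orbit_sum a k) = G *m (A b *m orbit_limit a)
  - G *m mxword A (b :: nseq k a) *m K *m (Z a *m (G *m d)).
Proof.
(* Modulo the kernel of [G], the partial sums and the vectors [s - A_a^k s], with [s] the orbit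
   limit, both start at 0 and satisfy the recursion [x -> d + A_a x]. *)
pose delta := orbit_sum a k - orbit_limit a + mxword A (nseq k a) *m orbit_limit a.
suff: G *m delta = 0.
  have [X EX] := gram_invariant r A b => /(congr1 (mulmx X)).
  rewrite mulmx0 mulmxA -EX -mulmxA /delta !(mulmxDr, mulmxN) mxword_cons => E.
  by apply/eqP; rewrite -subr_eq0 -[X in _ == X]E opprB addrA addrAC /orbit_limit !mulmxA.
rewrite /delta; elim: k {delta} => [|k IHk].
  by rewrite mxword_nil mul1mx sub0r addNr mulmx0.
have [X EX] := gram_invariant r A a.
have := congr1 (mulmx X) IHk; rewrite mulmx0 mulmxA -EX -mulmxA.
rewrite [nseq k.+1 a]/= mxword_cons [orbit_sum a k.+1]/= => E.
have := orbit_limit_eq a; rewrite mulmxBl mul1mx mulmxBr => E2.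
rewrite -[RHS]E !(mulmxDr, mulmxN) -E2 !mulmxA; congr (_ + _).
by rewrite addrAC [X in X + _]addrAC subrr add0r addrC.
Qed.

End OrbitSums.

(** * Continuity of average preserving automata by linear algebra *)

Section AveragePreserving.
Variables (R : realType) (A : wfa R bool).
Hypothesis apA : average_preserving A.

Let n := states A.
Let r := init A.
Let B := trans A.
Let d := trans A false *m final A - final A.
Let G := gram r B n.
Let K := gram d^T (fun a => (B a)^T) n.

Lemma final_false : trans A false *m final A = final A + d.
Proof. by rewrite /d addrC subrK. Qed.

Lemma final_true : trans A true *m final A = final A - d.
Proof.
move: apA; rewrite /average_preserving big_bool card_bool scaler_nat mulr2n => E.
by rewrite /d opprB addrA -E addrK.
Qed.

(** The mean property makes the increments for the two letters opposite, so the single vector [d]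
    governs both. *)
Lemma wfa_word_step v a : wfa_word A (rcons v a) =
  wfa_word A v + (r *m mxword B v *m (if a then - d else d)) ord0 ord0.
Proof.
rewrite /wfa_word mxword_rcons -!mulmxA.
have -> : trans A a *m final A = final A + (if a then - d else d).
  by case: a; rewrite ?final_true ?final_false.
by rewrite !mulmxDr mxE.
Qed.

Lemma unif_cauchy_vanishing :
  unif_cauchy (wfa_word A) -> vanishing (fun w => r *m mxword B w *m d).
Proof.
move=> ucg e /ucg[D HD]; exists D => v le_v.
apply: le_trans (l1norm_le (e := e) _) _ => [i j|]; last by rewrite mul1r.
rewrite !ord1; have := HD (take D v) (rcons (drop D v) false) (drop D v).
rewrite size_takel // -rcons_cat cat_take_drop wfa_word_step => /(_ erefl).
by rewrite addrC addKr.
Qed.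

(** By [minimal_gram], the increments of [wfa_word] are also increments along the compressed
    matrices, so [vanishing_unif_cauchy] applies to these in place of the original ones. *)
Lemma stable_unif_cauchy Z : G *m K *m Z *m (G *m K) = G *m K ->
  stable (minimal_trans r d B Z) <-> unif_cauchy (wfa_word A).
Proof.
move=> ginvZ; have stE := stable_minimal_trans ginvZ.
split=> [/stableP vanB|/unif_cauchy_vanishing/stE//].
have [y Ey] := gram_row r B [::]; rewrite mxword_nil mulmx1 in Ey.
have [z Ez] := gram_col d B.
apply: (vanishing_unif_cauchy (B := minimal_trans r d B Z) (r := y *m G)
         (c := fun a => if a then - (K *m z) else K *m z)) => // v a.
rewrite wfa_word_step; congr (_ + _).
have E : r *m mxword B v *m d = y *m G *m mxword (minimal_trans r d B Z) v *m (K *m z).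
  transitivity (y *m (G *m mxword (minimal_trans r d B Z) v *m K) *m z); last by rewrite !mulmxA.
  transitivity (y *m G *m mxword B v *m (K *m z)); first by rewrite -Ey -Ez.
  by rewrite minimal_gram // !mulmxA.
by case: a; rewrite ?mulmxN E.
Qed.

Lemma final_false_iter k : mxword B (nseq k false) *m final A = final A + orbit_sum d B false k.
Proof.
elim: k => [|k IHk]; first by rewrite mxword_nil mul1mx addr0.
by rewrite [nseq _ _]/= mxword_cons -mulmxA IHk mulmxDr final_false -addrA.
Qed.

Lemma final_true_iter k : mxword B (nseq k true) *m final A = final A - orbit_sum d B true k.
Proof.
elim: k => [|k IHk]; first by rewrite mxword_nil mul1mx subr0.
by rewrite [nseq _ _]/= mxword_cons -mulmxA IHk mulmxBr final_true -addrA -opprD.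
Qed.

Variable Z : bool -> 'M[R]_n.
Hypothesis ginvZ : forall a,
  G *m (1%:M - B a) *m K *m Z a *m (G *m (1%:M - B a) *m K) = G *m (1%:M - B a) *m K.

(** This is the limit of [G (A_0 A_1^k F - A_1 A_0^k F)], obtained from
    [A_1^k F = F - orbit_sum true k] and [A_0^k F = F + orbit_sum false k]. *)
Definition dyadic_gap : 'cV[R]_n :=
  G *m (d + d - B false *m orbit_limit r d B Z true - B true *m orbit_limit r d B Z false).

(** The difference at [s] is [r A_s D_k] with [r A_s = y G], and [G D_k] tends to [dyadic_gap].
    Conversely, agreement at all [s] makes every [r A_s] annihilate the vector inside the gap, and
    [gram_mul0] concludes. *)
Lemma dyadic_agreeP : unif_cauchy (wfa_word A) ->
  dyadic_agree (wfa_word A) <-> dyadic_gap = 0.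
Proof.
move=> /unif_cauchy_vanishing/vanishing_gram vanG.
have osl := orbit_sum_limit vanG ginvZ.
pose D k := d + d - B false *m orbit_sum d B true k - B true *m orbit_sum d B false k.
pose Y a : 'cV[R]_n := Z a *m (G *m d).
pose err a b k := G *m mxword B (b :: nseq k a) *m K *m Y a.
have gE s k : wfa_word A (s ++ false :: nseq k true) - wfa_word A (s ++ true :: nseq k false)
    = (r *m mxword B s *m D k) ord0 ord0.
  transitivity ((r *m mxword B s *m (B false *m (mxword B (nseq k true) *m final A)
                 - B true *m (mxword B (nseq k false) *m final A))) ord0 ord0).
    by rewrite /wfa_word !mxword_cat !mxword_cons mulmxBr !mulmxA [RHS]mxE [X in _ = _ + X]mxE.
  congr ((_ *m _) _ _); rewrite final_false_iter final_true_iter mulmxBr mulmxDr.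
  rewrite final_false final_true /D; move: (B false *m _) (B true *m _) => x y.
  by apply/matrixP => i j; rewrite !mxE; ring.
have GD k : G *m D k = dyadic_gap + (err true false k + err false true k).
  rewrite /D /dyadic_gap !mulmxBr !osl -/(err _ _ _) -/(err _ _ _).
  move: (G *m (d + d)) (G *m (B _ *m _)) (G *m (B _ *m _)) (err _ _ _) (err _ _ _).
  by move=> x1 x2 x3 x4 x5; apply/matrixP => i j; rewrite !mxE; ring.
have limGD (y : 'rV[R]_n) (e : R) : 0 < e -> exists K0, forall k, (K0 <= k)%N ->
    `|(y *m G *m D k) ord0 ord0 - (y *m dyadic_gap) ord0 ord0| <= e.
  move=> e0; have e20 := divr_gt0 e0 (ltr0n R 2).
  have [D1 HD1] := vanishingM y (Y true) vanG e20.
  have [D2 HD2] := vanishingM y (Y false) vanG e20.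
  have errE a b k : y *m err a b k = y *m (G *m mxword B (b :: nseq k a) *m K) *m Y a.
    by rewrite /err !mulmxA.
  exists (maxn D1 D2) => k; rewrite geq_max => /andP[le1 le2].
  have -> : (y *m G *m D k) ord0 ord0 - (y *m dyadic_gap) ord0 ord0
      = (y *m err true false k + y *m err false true k) ord0 ord0.
    have addKmx (x z : 'M[R]_1) : (x + z) ord0 ord0 - x ord0 ord0 = z ord0 ord0.
      by rewrite mxE addrC addKr.
    by rewrite -mulmxA GD !mulmxDr addKmx.
  rewrite !errE mxE.
  apply: le_trans (ler_normD _ _) _; rewrite [leRHS](splitr e) lerD //.
    by apply: le_trans (l1norm_entry _ _ _) (HD1 _ _); rewrite /= size_nseq ltnW.
  by apply: le_trans (l1norm_entry _ _ _) (HD2 _ _); rewrite /= size_nseq ltnW.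
split=> [dyad|gap0 s e e0]; last first.
  have [y Ey] := gram_row r B s; have [K0 HK] := limGD y e e0.
  by exists K0 => k /HK; rewrite gE Ey gap0 mulmx0 [X in _ - X]mxE subr0.
apply: gram_mul0 => s _; have [y Ey] := gram_row r B s.
apply/matrixP => i j; rewrite !ord1 [RHS]mxE Ey -mulmxA -/dyadic_gap.
apply/eqP; rewrite -normr_le0; apply: ler_small => e e0; rewrite add0r.
have e20 := divr_gt0 e0 (ltr0n R 2).
have [K1 HK1] := dyad s _ e20; have [K2 HK2] := limGD y _ e20.
have := HK2 _ (leq_maxr K1 K2); have := HK1 _ (leq_maxl K1 K2); rewrite gE Ey.
set x := (_ *m D _) _ _; set z := (y *m _) _ _; rewrite !ler_norml; lra.
Qed.

End AveragePreserving.

(** * Numbers and matrices on codes *)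

Section Subfield.
Variables (R : realType) (N : numbering R).

Definition subfield : {pred R} := fun x => `[< exists c, val N c = x >].

Lemma val_cst : [/\ exists c, val N c = 1, exists c, val N c = 0 & exists c, val N c = -1].
Proof.
have [m Em] := val_m1 N; have [a _ aE] := add_computable N; have [f _ fE] := mul_computable N.
have E1 : val N (f (npair m m)) = 1 by rewrite fE Em mulrNN mulr1.
split; [by exists (f (npair m m))| |by exists m].
by exists (a (npair m (f (npair m m)))); rewrite aE Em E1 addNr.
Qed.

Lemma subfield_closed : divring_closed subfield.
Proof.
have [[c1 E1] [z Ez] [m Em]] := val_cst.
have [a _ aE] := add_computable N; have [f _ fE] := mul_computable N.
have [q _ qE] := div_computable N.
split; first by apply/asboolP; exists c1.
  move=> _ _ /asboolP[x <-] /asboolP[y <-]; apply/asboolP.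
  by exists (a (npair x (f (npair m y)))); rewrite aE fE Em mulN1r.
move=> _ _ /asboolP[x <-] /asboolP[y <-]; apply/asboolP.
(* The division program promises nothing for a zero divisor, where the quotient is 0 by
   convention. *)
have [y0|y0] := eqVneq (val N y) 0; last by exists (q (npair x y)); rewrite qE.
by exists z; rewrite y0 invr0 mulr0.
Qed.

HB.instance Definition _ := GRing.isDivringClosed.Build R subfield subfield_closed.

Record subfield_type := SubfieldType { sf_val : R; _ : sf_val \in subfield }.

HB.instance Definition _ := [isSub for sf_val].
HB.instance Definition _ := [Choice of subfield_type by <:].
HB.instance Definition _ := [SubChoice_isSubIntegralDomain of subfield_type by <:].
HB.instance Definition _ := [SubIntegralDomain_isSubField of subfield_type by <:].

Fact sf_val_zmod_morphism : zmod_morphism sf_val. Proof. by []. Qed.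
Fact sf_val_monoid_morphism : monoid_morphism sf_val. Proof. by []. Qed.

HB.instance Definition _ :=
  GRing.isZmodMorphism.Build subfield_type R sf_val sf_val_zmod_morphism.
HB.instance Definition _ :=
  GRing.isMonoidMorphism.Build subfield_type R sf_val sf_val_monoid_morphism.

(** The pseudo-inverse is taken over the subfield, so that its entries have codes. *)
Lemma ginv_exists n (M : 'M[nat]_n) : exists Z : 'M[nat]_n,
  let v A : 'M[R]_n := map_mx (val N) A in v M *m v Z *m v M = v M.
Proof.
have sfP c : val N c \in subfield by apply/asboolP; exists c.
pose MF : 'M[subfield_type]_n := map_mx (fun c => SubfieldType (sfP c)) M.
have EM : map_mx (val N) M = map_mx sf_val MF by apply/matrixP => i j; rewrite !mxE.
have /choice[cd cdE] (x : subfield_type) : exists c, val N c = sf_val x.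
  by case: x => x Hx /=; apply/asboolP.
exists (map_mx cd (pinvmx MF)) => /=.
have -> : map_mx (val N) (map_mx cd (pinvmx MF)) = map_mx sf_val (pinvmx MF).
  by apply/matrixP => i j; rewrite !mxE cdE.
by rewrite EM -!map_mxM mulmxKpV.
Qed.

End Subfield.

(** * Arithmetic on codes of numbers and matrices *)

Section NumberCodes.
Variables (R : realType) (N : numbering R).

(** The functions promised by the numbering are picked by choice; [reducible] asserts only that a
    program exists. *)
Definition addc (x y : nat) : nat := s2val (cid2 (add_computable N)) (npair x y).
Definition mulc (x y : nat) : nat := s2val (cid2 (mul_computable N)) (npair x y).
Definition eqc (x y : nat) : bool := val N x == val N y.

Lemma val_addc x y : val N (addc x y) = val N x + val N y.
Proof. exact: (s2valP' (cid2 (add_computable N))). Qed.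

Lemma val_mulc x y : val N (mulc x y) = val N x * val N y.
Proof. exact: (s2valP' (cid2 (mul_computable N))). Qed.

Lemma computable_addc f g : computable f -> computable g ->
  computable (fun x => addc (f x) (g x)).
Proof.
move=> cf cg; have ca := s2valP (cid2 (add_computable N)).
exact: (computable_comp ca (computable_pair cf cg)).
Qed.

Lemma computable_mulc f g : computable f -> computable g ->
  computable (fun x => mulc (f x) (g x)).
Proof.
move=> cf cg; have ca := s2valP (cid2 (mul_computable N)).
exact: (computable_comp ca (computable_pair cf cg)).
Qed.

Lemma computable_eqc f g : computable f -> computable g ->
  computable (fun x => eqc (f x) (g x) : nat).
Proof.
move=> cf cg; have [e ce eE] := eq_computable N.
apply: computable_ext (computable_comp ce (computable_pair cf cg)) => x.
exact: eE.
Qed.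

Definition code_m1 : nat := sval (cid (val_m1 N)).
Definition code_1 : nat := mulc code_m1 code_m1.
Definition code_0 : nat := addc code_1 code_m1.
Definition code_half : nat :=
  s2val (cid2 (div_computable N)) (npair code_1 (addc code_1 code_1)).

Lemma val_code_m1 : val N code_m1 = -1.
Proof. exact: (svalP (cid (val_m1 N))). Qed.

Lemma val_code_1 : val N code_1 = 1.
Proof. by rewrite val_mulc val_code_m1 mulrNN mulr1. Qed.

Lemma val_code_0 : val N code_0 = 0.
Proof. by rewrite val_addc val_code_1 val_code_m1 subrr. Qed.

Lemma val_code_half : val N code_half = 1 / 2.
Proof.
have E2 : val N (addc code_1 code_1) = 2 by rewrite val_addc val_code_1.
rewrite /code_half (s2valP' (cid2 (div_computable N))) E2 ?val_code_1 //.
Qed.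

Definition sumc (n : nat) (f : nat -> nat) : nat :=
  iteri n (fun i s => addc s (f i)) code_0.

Lemma val_sumc n f : val N (sumc n f) = \sum_(i < n) val N (f i).
Proof.
elim: n => [|n IHn]; first by rewrite big_ord0 val_code_0.
by rewrite big_ord_recr /= -IHn -val_addc.
Qed.

Lemma computable_sumc n (f : nat -> nat -> nat) : computable n ->
  computable (fun z => f (nfst z) (nsnd z)) -> computable (fun x => sumc (n x) (f x)).
Proof.
move=> cn cf; apply: (computable_iteri (step := fun x i s => addc s (f x i))) => //.
  apply: computable_addc; first by repeat computability_step.
  by apply: (computable2 cf); repeat computability_step.
exact: computable_cst.
Qed.

(** Every natural number is read as a matrix of any shape, so programs on matrices carry no
    well-formedness conditions. *)
Definition mxval m n (M : nat) : 'M[R]_(m, n) := \matrix_(i, j) val N (ent M i j).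

Definition mulmxc (m n p A B : nat) : nat :=
  tabmx m p (fun i j => sumc n (fun k => mulc (ent A i k) (ent B k j))).
Definition addmxc (m n A B : nat) : nat :=
  tabmx m n (fun i j => addc (ent A i j) (ent B i j)).
Definition submxc (m n A B : nat) : nat :=
  tabmx m n (fun i j => addc (ent A i j) (mulc code_m1 (ent B i j))).
Definition trmxc (m n A : nat) : nat := tabmx n m (fun i j => ent A j i).
Definition scalarmxc (n c : nat) : nat :=
  tabmx n n (fun i j => if i == j then c else code_0).
Definition eqmxc (m n A B : nat) : bool :=
  all (fun i => all (fun j => eqc (ent A i j) (ent B i j)) (iota 0 n)) (iota 0 m).

Lemma mxval_tabmx m n f : mxval m n (tabmx m n f) = \matrix_(i, j) val N (f i j).
Proof. by apply/matrixP => i j; rewrite !mxE ent_tabmx. Qed.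

Lemma mxval_code_mx m n (A : 'M[nat]_(m, n)) : mxval m n (code_mx A) = map_mx (val N) A.
Proof. by apply/matrixP => i j; rewrite !mxE ent_code_mx. Qed.

Lemma mxval_mul m n p A B :
  mxval m p (mulmxc m n p A B) = mxval m n A *m mxval n p B.
Proof.
rewrite mxval_tabmx; apply/matrixP => i j; rewrite !mxE val_sumc.
by apply: eq_bigr => k _; rewrite !mxE val_mulc.
Qed.

Lemma mxval_add m n A B : mxval m n (addmxc m n A B) = mxval m n A + mxval m n B.
Proof. by rewrite mxval_tabmx; apply/matrixP => i j; rewrite !mxE val_addc. Qed.

Lemma mxval_sub m n A B : mxval m n (submxc m n A B) = mxval m n A - mxval m n B.
Proof.
rewrite mxval_tabmx; apply/matrixP => i j.
by rewrite !mxE val_addc val_mulc val_code_m1 mulN1r.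
Qed.

Lemma mxval_tr m n A : mxval n m (trmxc m n A) = (mxval m n A)^T.
Proof. by rewrite mxval_tabmx; apply/matrixP => i j; rewrite !mxE. Qed.

Lemma mxval_scalar n c : mxval n n (scalarmxc n c) = (val N c)%:M.
Proof.
rewrite mxval_tabmx; apply/matrixP => i j; rewrite !mxE -val_eqE /=.
by case: eqP => _; rewrite ?val_code_0.
Qed.

Lemma eqmxcP m n A B : reflect (mxval m n A = mxval m n B) (eqmxc m n A B).
Proof.
apply: (iffP allP) => [E|/matrixP E i].
  apply/matrixP => i j; rewrite !mxE; have := E i; rewrite mem_iota /= add0n => /(_ (ltn_ord i)).
  by move=> /allP/(_ j); rewrite mem_iota /= add0n => /(_ (ltn_ord j))/eqP.
rewrite mem_iota add0n /= => lt_i; apply/allP => j; rewrite mem_iota add0n /= => lt_j.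
by have := E (Ordinal lt_i) (Ordinal lt_j); rewrite !mxE => /eqP.
Qed.

Lemma computable_all n (p : nat -> nat -> bool) : computable n ->
  computable (fun z => p (nfst z) (nsnd z) : nat) ->
  computable (fun x => all (p x) (iota 0 (n x)) : nat).
Proof.
move=> cn cp; apply: (@computable_ext (fun x =>
    iteri (n x) (fun i acc => if p x i then acc else 0%N) 1%N)).
  move=> x; elim: (n x) => // k IHk; rewrite [LHS]/= IHk -[in RHS]addn1 iotaD all_cat.
  by rewrite add0n /= andbT andbC; case: (p x k).
apply: computable_iteri => //; last exact: computable_cst.
apply: computable_if.
- by apply: (computable2 (F := fun x y => nat_of_bool (p x y)) cp); repeat computability_step.
- by repeat computability_step.
- by repeat computability_step.
Qed.

End NumberCodes.

(** * From uniform continuity to stability *)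

Ltac number_step := first
  [ lazymatch goal with
    | |- computable (fun x => addc _ _ _) => apply: computable_addc
    | |- computable (fun x => mulc _ _ _) => apply: computable_mulc
    | |- computable (fun x => nat_of_bool (eqc _ _ _)) => apply: computable_eqc
    | |- computable (fun x => sumc _ _ _) => apply: computable_sumc
    | |- computable (fun x => nat_of_bool (all _ _)) => apply: computable_all
    end
  | computability_step ].

Section MatrixPrograms.
Variables (R : realType) (N : numbering R).

Lemma computable_mulmxc m n p A B :
  computable m -> computable n -> computable p -> computable A -> computable B ->
  computable (fun x => mulmxc N (m x) (n x) (p x) (A x) (B x)).
Proof. by move=> cm cn cp cA cB; rewrite /mulmxc; repeat number_step. Qed.

Lemma computable_addmxc m n A B :
  computable m -> computable n -> computable A -> computable B ->
  computable (fun x => addmxc N (m x) (n x) (A x) (B x)).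
Proof. by move=> cm cn cA cB; rewrite /addmxc; repeat number_step. Qed.

Lemma computable_submxc m n A B :
  computable m -> computable n -> computable A -> computable B ->
  computable (fun x => submxc N (m x) (n x) (A x) (B x)).
Proof. by move=> cm cn cA cB; rewrite /submxc; repeat number_step. Qed.

Lemma computable_trmxc m n A : computable m -> computable n -> computable A ->
  computable (fun x => trmxc (m x) (n x) (A x)).
Proof. by move=> cm cn cA; rewrite /trmxc; repeat number_step. Qed.

Lemma computable_scalarmxc n c : computable n -> computable c ->
  computable (fun x => scalarmxc N (n x) (c x)).
Proof. by move=> cn cc; rewrite /scalarmxc; repeat number_step. Qed.

Lemma computable_eqmxc m n A B :
  computable m -> computable n -> computable A -> computable B ->
  computable (fun x => eqmxc N (m x) (n x) (A x) (B x) : nat).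
Proof. by move=> cm cn cA cB; rewrite /eqmxc; repeat number_step. Qed.

End MatrixPrograms.

Ltac matrix_step := first
  [ lazymatch goal with
    | |- computable (fun x => mulmxc _ _ _ _ _ _) => apply: computable_mulmxc
    | |- computable (fun x => addmxc _ _ _ _ _) => apply: computable_addmxc
    | |- computable (fun x => submxc _ _ _ _ _) => apply: computable_submxc
    | |- computable (fun x => trmxc _ _ _) => apply: computable_trmxc
    | |- computable (fun x => scalarmxc _ _ _) => apply: computable_scalarmxc
    | |- computable (fun x => nat_of_bool (eqmxc _ _ _ _ _)) => apply: computable_eqmxc
    end
  | number_step ].

Section UniformContinuityProgram.
Variables (R : realType) (N : numbering R).

(** Candidates are searched through until one passes the decidable test; [ginv_exists] guarantees
    success. *)
Lemma ginvc_exists : exists2 f, computable f &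
  forall n M, let v := mxval N n n in v M *m v (f (npair n M)) *m v M = v M.
Proof.
pose P x Z := let n := nfst x in let M := nsnd x in
  eqmxc N n n (mulmxc N n n n (mulmxc N n n n M Z) M) M.
have [|x|f cf fP] := @computable_mu P.
- by rewrite /P; repeat matrix_step.
- pose n := nfst x; pose M : 'M[nat]_n := \matrix_(i, j) ent (nsnd x) i j.
  have [Z] := ginv_exists N M; rewrite /= => EZ.
  have EM : mxval N n n (nsnd x) = map_mx (val N) M.
    by apply/matrixP => i j; rewrite !mxE.
  by exists (code_mx Z); apply/eqmxcP; rewrite !mxval_mul mxval_code_mx EM.
exists f => // n M v; have /eqmxcP := fP (npair n M).
by rewrite /= !npairE !mxval_mul.
Qed.

Definition ginvc (n M : nat) : nat := s2val (cid2 ginvc_exists) (npair n M).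

Lemma ginvcP n M : let v := mxval N n n in v M *m v (ginvc n M) *m v M = v M.
Proof. exact: (s2valP' (cid2 ginvc_exists)). Qed.

(* Congruence forms: rewriting under [mxval] would compare unfolded programs. *)
Lemma ginvc_eq n M X : mxval N n n M = X -> X *m mxval N n n (ginvc n M) *m X = X.
Proof. by move=> <-; exact: ginvcP. Qed.

Lemma mxval_mulE m n p A B X Y : mxval N m n A = X -> mxval N n p B = Y ->
  mxval N m p (mulmxc N m n p A B) = X *m Y.
Proof. by move=> <- <-; exact: mxval_mul. Qed.

Lemma mxval_addE m n A B X Y : mxval N m n A = X -> mxval N m n B = Y ->
  mxval N m n (addmxc N m n A B) = X + Y.
Proof. by move=> <- <-; exact: mxval_add. Qed.

Lemma mxval_subE m n A B X Y : mxval N m n A = X -> mxval N m n B = Y ->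
  mxval N m n (submxc N m n A B) = X - Y.
Proof. by move=> <- <-; exact: mxval_sub. Qed.

Lemma computable_ginvc n M : computable n -> computable M ->
  computable (fun x => ginvc (n x) (M x)).
Proof.
move=> cn cM; have cg := s2valP (cid2 ginvc_exists).
exact: (computable_comp cg (computable_pair cn cM)).
Qed.

Definition gramc (k n r A0 A1 : nat) : nat :=
  iteri k (fun _ G => addmxc N n n (addmxc N n n (mulmxc N n 1 n (trmxc 1 n r) r)
      (mulmxc N n n n (mulmxc N n n n (trmxc n n A0) G) A0))
      (mulmxc N n n n (mulmxc N n n n (trmxc n n A1) G) A1))
    (scalarmxc N n (code_0 N)).

Lemma computable_gramc k n r A0 A1 :
  computable k -> computable n -> computable r -> computable A0 -> computable A1 ->
  computable (fun x => gramc (k x) (n x) (r x) (A0 x) (A1 x)).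
Proof.
move=> ck cn cr c0 c1; rewrite /gramc.
by apply: computable_iteri; repeat matrix_step.
Qed.

Lemma mxval_gramc k n r A0 A1 : mxval N n n (gramc k n r A0 A1)
  = gram (mxval N 1 n r) (fun a => if a then mxval N n n A1 else mxval N n n A0) k.
Proof.
rewrite /gramc /gram; elim: k => [|k IHk] /=.
  by rewrite mxval_scalar val_code_0 raddf0.
by rewrite !mxval_add !mxval_mul !mxval_tr IHk.
Qed.

(** * Programs for the compressed pair and the dyadic gap *)

Section Programs.
Variables n r F A0 A1 : nat.

Definition defectc : nat := submxc N n 1 (mulmxc N n n 1 A0 F) F.
Definition rowgramc : nat := gramc n n r A0 A1.
Definition colgramc : nat :=
  gramc n n (trmxc n 1 defectc) (trmxc n n A0) (trmxc n n A1).
Definition projc : nat :=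
  mulmxc N n n n (mulmxc N n n n colgramc
    (ginvc n (mulmxc N n n n rowgramc colgramc))) rowgramc.
Definition minimal_transc (A : nat) : nat :=
  mulmxc N n n n (mulmxc N n n n projc A) projc.
Definition orbit_mxc (A : nat) : nat :=
  mulmxc N n n n (mulmxc N n n n rowgramc
    (submxc N n n (scalarmxc N n (code_1 N)) A)) colgramc.
Definition orbit_limitc (A : nat) : nat :=
  mulmxc N n n 1 colgramc (mulmxc N n n 1 (ginvc n (orbit_mxc A))
    (mulmxc N n n 1 rowgramc defectc)).
Definition dyadic_gapc : nat :=
  mulmxc N n n 1 rowgramc (submxc N n 1 (submxc N n 1 (addmxc N n 1 defectc defectc)
    (mulmxc N n n 1 A0 (orbit_limitc A1))) (mulmxc N n n 1 A1 (orbit_limitc A0))).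

Let A : wfa R bool := Wfa (mxval N 1 n r) (mxval N n 1 F)
  (fun a => mxval N n n (if a then A1 else A0)).
Let d : 'cV[R]_n := trans A false *m final A - final A.

Lemma mxval_defectc : mxval N n 1 defectc = d.
Proof. by rewrite mxval_sub mxval_mul. Qed.

Lemma mxval_rowgramc : mxval N n n rowgramc = gram (init A) (trans A) n.
Proof.
rewrite mxval_gramc; congr (gram _ _ _); apply/funext => -[].
Qed.

Lemma mxval_colgramc : mxval N n n colgramc = gram d^T (fun a => (trans A a)^T) n.
Proof.
rewrite mxval_gramc mxval_tr mxval_defectc !mxval_tr; congr (gram _ _ _); apply/funext => -[].
Qed.

Lemma stable_minimal_transc : average_preserving A ->
  stable (fun a : bool => mxval N n n (if a then minimal_transc A1 else minimal_transc A0)) <->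
  unif_cauchy (wfa_word A).
Proof.
move=> apA; pose Z := mxval N n n (ginvc n (mulmxc N n n n rowgramc colgramc)).
have ginvZ := ginvc_eq (mxval_mulE mxval_rowgramc mxval_colgramc).
rewrite -(stable_unif_cauchy apA ginvZ).
have projE : mxval N n n projc = _ :=
  mxval_mulE (mxval_mulE mxval_colgramc (erefl Z)) mxval_rowgramc.
suff -> : (fun a : bool => mxval N n n (if a then minimal_transc A1 else minimal_transc A0))
    = minimal_trans (init A) d (trans A) Z by [].
apply/funext => -[].
  exact: (mxval_mulE (mxval_mulE projE (erefl (trans A true))) projE).
exact: (mxval_mulE (mxval_mulE projE (erefl (trans A false))) projE).
Qed.

Lemma dyadic_gapcP : average_preserving A -> unif_cauchy (wfa_word A) ->
  dyadic_agree (wfa_word A) <-> mxval N n 1 dyadic_gapc = 0.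
Proof.
move=> apA ucA; pose Z a := mxval N n n (ginvc n (orbit_mxc (if a then A1 else A0))).
have oneE : mxval N n n (scalarmxc N n (code_1 N)) = 1%:M.
  by rewrite mxval_scalar val_code_1.
have orbitE a : mxval N n n (orbit_mxc (if a then A1 else A0)) = _ :=
  mxval_mulE (mxval_mulE mxval_rowgramc (mxval_subE oneE (erefl (trans A a)))) mxval_colgramc.
rewrite (dyadic_agreeP apA (Z := Z)) //; last by move=> a; exact: ginvc_eq (orbitE a).
have limE a : mxval N n 1 (orbit_limitc (if a then A1 else A0)) = _ :=
  mxval_mulE mxval_colgramc (mxval_mulE (erefl (Z a)) (mxval_mulE mxval_rowgramc mxval_defectc)).
suff -> : mxval N n 1 dyadic_gapc = @dyadic_gap R A Z by [].
exact: (mxval_mulE mxval_rowgramc (mxval_subE (mxval_subE (mxval_addE mxval_defectc mxval_defectc)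
  (mxval_mulE (erefl (trans A false)) (limE true))) (mxval_mulE (erefl (trans A true)) (limE false)))).
Qed.

End Programs.

(** This transfers stability in both directions between the alphabets [bool] and ['I_2]. *)
Lemma stable_comp (T T' : Type) n (A : T -> 'M[R]_n) (f : T' -> T) :
  stable A -> stable (fun a => A (f a)).
Proof.
move=> stA w; have := stA (fun i => f (w i)).
suff E k : mxword A (pref k (fun i => f (w i))) = mxword (fun a => A (f a)) (pref k w).
  by under eq_fun do rewrite E.
have -> : pref k (fun i => f (w i)) = map f (pref k w) by rewrite /pref /mkseq -map_comp.
by rewrite /mxword big_map.
Qed.

Definition binary_familyc (n B0 B1 : nat) : nat :=
  code_seq [:: n; 1%N; code_seq [:: B0; B1]].

(** The oracle answers only on genuine codes of families; a number produced by [tabmx] is the code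
    of a matrix. *)
Lemma code_binary_family n B0 B1 (Q : Prop) :
    (exists f, B0 = tabmx n n f) -> (exists f, B1 = tabmx n n f) ->
    (stable (fun a : bool => mxval N n n (if a then B1 else B0)) <-> Q) ->
  exists2 X : mx_family nat, code_mx_family X = binary_familyc n B0 B1 &
    stable (fun a => map_mx (val N) (mf_mx X a)) <-> Q.
Proof.
move=> [f0 E0] [f1 E1] stQ.
pose M (a : 'I_2) : 'M[nat]_n := \matrix_(i, j) ent (if a == 1%N :> nat then B1 else B0) i j.
exists (@MxFamily nat n 1 M).
  rewrite /code_mx_family /binary_familyc !enum_ordSl enum_ord0 /= /M /=.
  by rewrite E0 E1 !code_mx_ent.
have EM a : map_mx (val N) (M a) = mxval N n n (if a == 1%N :> nat then B1 else B0).
  by apply/matrixP => i j; rewrite !mxE.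
apply: (iff_trans _ stQ); split=> stB.
  have := stable_comp (fun a : bool => if a then ord_max else ord0 : 'I_2) stB.
  by congr stable; apply/funext => -[]; rewrite /= EM.
have := stable_comp (fun a : 'I_2 => a == 1%N :> nat) stB.
by congr stable; apply/funext => a; rewrite /= EM.
Qed.

Lemma uniform_continuity_reducible :
  reducible (ap_wfa_uniform_continuity N) (matrix_product_stability N).
Proof.
pose n x := nthc x 0; pose r x := nthc x 1; pose F x := nthc x 2.
pose A0 x := nthc x 3; pose A1 x := nthc x 4.
have cn : computable n by rewrite /n; repeat computability_step.
have cr : computable r by rewrite /r; repeat computability_step.
have cF : computable F by rewrite /F; repeat computability_step.
have c0 : computable A0 by rewrite /A0; repeat computability_step.
have c1 : computable A1 by rewrite /A1; repeat computability_step.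
pose B x a := minimal_transc (n x) (r x) (F x) (A0 x) (A1 x) a.
pose out x := binary_familyc (n x) (B x (A0 x)) (B x (A1 x)).
pose gap x := eqmxc N (n x) 1 (dyadic_gapc (n x) (r x) (F x) (A0 x) (A1 x))
  (tabmx (n x) 1 (fun _ _ => code_0 N)).
have cdef : computable (fun x => defectc (n x) (F x) (A0 x)).
  by rewrite /defectc; repeat matrix_step.
have cG : computable (fun x => rowgramc (n x) (r x) (A0 x) (A1 x)).
  by apply: computable_gramc; repeat matrix_step.
have cK : computable (fun x => colgramc (n x) (F x) (A0 x) (A1 x)).
  by apply: computable_gramc; repeat matrix_step.
have cproj : computable (fun x => projc (n x) (r x) (F x) (A0 x) (A1 x)).
  by rewrite /projc; repeat first [matrix_step | apply: computable_ginvc].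
have cB a : computable a -> computable (fun x => B x (a x)).
  by move=> ca; rewrite /B /minimal_transc; repeat matrix_step.
have cB0 := cB _ c0; have cB1 := cB _ c1.
have [co Ho] : computable out by rewrite /out /binary_familyc /=; repeat computability_step.
have clim a : computable a ->
    computable (fun x => orbit_limitc (n x) (r x) (F x) (A0 x) (A1 x) (a x)).
  move=> ca; rewrite /orbit_limitc /orbit_mxc.
  by repeat first [matrix_step | apply: computable_ginvc].
have [cg Hg] : computable (fun x => gap x : nat).
  have cl0 := clim _ c0; have cl1 := clim _ c1.
  by rewrite /gap /dyadic_gapc; repeat matrix_step.
have [cm Hm] : computable (fun z => nfst z * nsnd z)%N by repeat computability_step.
(* There is one query; the product of its answer with the test on the gap is their conjunction. *)
exists (PComp cm (PPair (PComp POracle co) cg)) => A /= apA.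
have En : n (code_wfa A) = states A by rewrite /n nthc_code.
have Er : r (code_wfa A) = code_mx (init A) by rewrite /r nthc_code.
have EF : F (code_wfa A) = code_mx (final A) by rewrite /F nthc_code.
have E0 : A0 (code_wfa A) = code_mx (trans A false) by rewrite /A0 nthc_code.
have E1 : A1 (code_wfa A) = code_mx (trans A true) by rewrite /A1 nthc_code.
have EA : map_wfa (val N) A = Wfa (mxval N 1 (states A) (code_mx (init A)))
    (mxval N (states A) 1 (code_mx (final A))) (fun a : bool =>
      mxval N (states A) (states A)
        (if a then code_mx (trans A true) else code_mx (trans A false))).
  by rewrite !mxval_code_mx; congr Wfa; apply/funext => -[]; rewrite mxval_code_mx.
rewrite EA in apA *; set RA := Wfa _ _ _ in apA *.
have [X EX stX] : exists2 X, code_mx_family X = out (code_wfa A) &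
    stable (fun a => map_mx (val N) (mf_mx X a)) <-> unif_cauchy (wfa_word RA).
  rewrite /out /B En Er EF E0 E1.
  by apply: (code_binary_family _ _ (stable_minimal_transc apA)); eexists.
have gapE : gap (code_wfa A) = eqmxc N (states A) 1
    (dyadic_gapc (states A) (code_mx (init A)) (code_mx (final A))
       (code_mx (trans A false)) (code_mx (trans A true)))
    (tabmx (states A) 1 (fun _ _ => code_0 N)) by rewrite /gap En Er EF E0 E1.
(* The test is meaningful in the uniformly Cauchy case; otherwise the answer 0 of the oracle settles
   the product. *)
have gapP : unif_cauchy (wfa_word RA) ->
    gap (code_wfa A) <-> dyadic_agree (wfa_word RA).
  move=> ucA; rewrite (dyadic_gapcP apA ucA) gapE.
  have Z0 : mxval N (states A) 1 (tabmx (states A) 1 (fun _ _ => code_0 N)) = 0.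
    by rewrite mxval_tabmx; apply/matrixP => i j; rewrite !mxE val_code_0.
  by split=> [/eqmxcP ->|E] //; apply/eqmxcP; rewrite Z0.
pose st := `[< stable (fun a => map_mx (val N) (mf_mx X a)) >].
exists (st * gap (code_wfa A))%N.
  exists (npair st (gap (code_wfa A))); last first.
    by have := eval_no_oracle _ (Hm (npair st (gap (code_wfa A)))); rewrite !npairE; apply.
  exists (st : nat), (gap (code_wfa A) : nat); split=> //; last exact: eval_no_oracle (Hg _).
  exists (out (code_wfa A)); first exact: eval_no_oracle (Ho _).
  by exists X; split=> //; rewrite /answer /= /st; case: asboolP => ?; [left|right].
rewrite /answer (everywhere_continuousP apA) /st.
case: asboolP => [/stX ucA|nst]; last by right; split=> // -[/stX].
case: (boolP (gap _)) => [/(gapP ucA)|ngap]; first by left.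
by right; split=> // -[_ /(gapP ucA)]; apply/negP.
Qed.

End UniformContinuityProgram.

(** * From stability to uniform continuity *)

Section WordFunctionLimits.
Variable R : realType.
Implicit Types (f : seq bool -> R) (u : nat -> R).

(** [unif_cauchy] for one fixed [e], which allows inductions in which [e] does not change. *)
Definition cauchy_at (e : R) f : Prop := exists D, forall w v v',
  size w = D -> `|f (w ++ v) - f (w ++ v')| <= e.

Lemma cauchy_at_cons e f f0 f1 :
  (forall v, f (false :: v) = f0 v) -> (forall v, f (true :: v) = f1 v) ->
  cauchy_at e f0 -> cauchy_at e f1 -> cauchy_at e f.
Proof.
move=> E0 E1 [D0 H0] [D1 H1]; exists (maxn D0 D1).+1 => -[//|a w] v v' [size_w].
have le0 : (D0 <= size w)%N by rewrite size_w leq_maxl.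
have le1 : (D1 <= size w)%N by rewrite size_w leq_maxr.
case: a; rewrite !cat_cons ?E0 ?E1.
  by rewrite -(cat_take_drop D1 w) -!catA; apply: H1; rewrite size_takel.
by rewrite -(cat_take_drop D0 w) -!catA; apply: H0; rewrite size_takel.
Qed.

Lemma cauchy_at_bounded e f : (forall v, `|f v| <= e) -> cauchy_at (e + e) f.
Proof. by move=> H; exists 0%N => w v v' _; rewrite (le_trans (ler_normB _ _)) // lerD. Qed.

Lemma cauchy_at0 e : 0 < e -> cauchy_at e (fun=> 0).
Proof. by move=> /ltW e0; exists 0%N => w v v' _; rewrite subrr normr0. Qed.

Lemma unif_cauchyZ c f : unif_cauchy f -> unif_cauchy (fun v => c * f v).
Proof.
move=> ucf e e0; have c0 : 0 < `|c| + 1 by rewrite ltr_wpDl.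
have [D HD] := ucf _ (divr_gt0 e0 c0); exists D => w v v' /HD => /(_ v v').
rewrite ler_pdivlMr // => le_e; rewrite -mulrBr normrM mulrC.
by apply: le_trans le_e; rewrite ler_wpM2l // lerDl.
Qed.

Lemma tends0_ext u u' : tends0 u -> u =1 u' -> tends0 u'.
Proof. by move=> H E e /H[K HK]; exists K => k; rewrite -E; exact: HK. Qed.

Lemma tends0_0 : tends0 (fun=> 0 : R).
Proof. by move=> e /ltW e0; exists 0%N => k _; rewrite normr0. Qed.
Arguments tends0_0 : clear implicits.

Lemma tends0D u u' : tends0 u -> tends0 u' -> tends0 (fun k => u k + u' k).
Proof.
move=> H H' e e0; have e20 := divr_gt0 e0 (ltr0n R 2).
have [K HK] := H _ e20; have [K' HK'] := H' _ e20.
exists (maxn K K') => k; rewrite geq_max => /andP[/HK le1 /HK' le2].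
by rewrite (le_trans (ler_normD _ _)) //; lra.
Qed.
Arguments tends0D {u u'}.

Lemma tends0Z c u : tends0 u -> tends0 (fun k => c * u k).
Proof.
move=> H e e0; have c0 : 0 < `|c| + 1 by rewrite ltr_wpDl.
have [K HK] := H _ (divr_gt0 e0 c0); exists K => k /HK.
rewrite ler_pdivlMr // => le_e; rewrite normrM mulrC.
by apply: le_trans le_e; rewrite ler_wpM2l // lerDl.
Qed.
Arguments tends0Z c {u}.

Lemma tends0_sum (I : finType) (u : I -> nat -> R) :
  (forall i, tends0 (u i)) -> tends0 (fun k => \sum_i u i k).
Proof.
move=> H; elim: (index_enum I) => [|i s IHs].
  by apply: (tends0_ext tends0_0) => k; rewrite big_nil.
by apply: (tends0_ext (tends0D (H i) IHs)) => k; rewrite big_cons.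
Qed.

Lemma tends0_shift u : tends0 (fun k => u k.+1) -> tends0 u.
Proof. by move=> H e /H[K HK]; exists K.+1 => -[//|k]; exact: HK. Qed.

Lemma tends0_exp2N : tends0 (fun k => 2 ^- k : R).
Proof.
move=> e /exp2N_small[K HK]; exists K => k /HK /ltW.
by rewrite ger0_norm // ltW // exp2N_gt0.
Qed.
Arguments tends0_exp2N : clear implicits.

End WordFunctionLimits.

(* [X w] is [num w] up to the choice of the tail, [T] is a tent function
   of [X], and [t] is a saw of two opposite tents: it vanishes at both ends and has average [0]. *)
Section Saw.
Variables (R : realType) (t T X : seq bool -> R).
Hypothesis X_nil : X [::] = 1 / 2.
Hypothesis X_cons : forall a v, X (a :: v) = (a%:R + X v) / 2.
Hypothesis T_nil : T [::] = 1 / 2.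
Hypothesis T_cons : forall a v, T (a :: v) = if a then 1 - X v else X v.
Hypothesis t_nil : t [::] = 0.
Hypothesis t_cons : forall a v, t (a :: v) = if a then - T v else T v.

Lemma X_itv v : 0 <= X v <= 1.
Proof. by elim: v => [|[] v IHv]; rewrite ?X_nil ?X_cons /=; lra. Qed.

Lemma T_itv v : 0 <= T v <= 1.
Proof.
case: v => [|[] v]; first by rewrite T_nil; lra.
  by rewrite T_cons; have := X_itv v; lra.
by rewrite T_cons; have := X_itv v; lra.
Qed.

Lemma saw_bounded v : `|t v| <= 1.
Proof.
rewrite ler_norml; case: v => [|[] v]; rewrite ?t_nil ?t_cons; first by lra.
  by have := T_itv v; lra.
by have := T_itv v; lra.
Qed.

Lemma unif_cauchy_X : unif_cauchy X.
Proof.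
have close u v v' : `|X (u ++ v) - X (u ++ v')| <= 2 ^- size u.
  elim: u => [|a u IHu].
    by rewrite expr0 invr1 ler_norml; have := X_itv v; have := X_itv v'; rewrite /=; lra.
  rewrite [size _]/= exp2N_half !cat_cons !X_cons -mulrBl opprD addrACA subrr add0r.
  by rewrite normrM [`|2^-1|]ger0_norm ?invr_ge0 // ler_pM2r ?invr_gt0.
move=> e /exp2N_small[D /(_ D (leqnn D)) /ltW HD]; exists D => u v v' size_u.
by apply: le_trans (close _ _ _) _; rewrite size_u.
Qed.

Lemma unif_cauchy_saw : unif_cauchy t.
Proof.
have ucT : unif_cauchy T.
  move=> e e0; have [D HD] := unif_cauchy_X e0.
  apply: (cauchy_at_cons (fun v => T_cons false v) (fun v => T_cons true v)).
    by exists D.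
  exists D => w v v' size_w.
  have -> : 1 - X (w ++ v) - (1 - X (w ++ v')) = - (X (w ++ v) - X (w ++ v')) by ring.
  by rewrite normrN; exact: HD.
move=> e e0; have [D HD] := ucT _ e0.
apply: (cauchy_at_cons (fun v => t_cons false v) (fun v => t_cons true v)).
  by exists D.
by exists D => w v v' size_w; rewrite -opprD normrN; exact: HD.
Qed.

Lemma X_false k : X (nseq k false) = 2 ^- k / 2.
Proof.
elim: k => [|k IHk]; first by rewrite X_nil expr0 invr1.
by rewrite [nseq _ _]/= X_cons add0r IHk exp2N_half.
Qed.

Lemma X_true k : X (nseq k true) = 1 - 2 ^- k / 2.
Proof.
elim: k => [|k IHk]; first by rewrite X_nil expr0 invr1; lra.
by rewrite [nseq _ _]/= X_cons IHk exp2N_half /=; lra.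
Qed.

Lemma tends0_T b : tends0 (fun k => T (nseq k b)).
Proof.
apply: tends0_shift; apply: (tends0_ext (tends0Z (1 / 2) (@tends0_exp2N R))) => k.
by case: b; rewrite [nseq _ _]/= T_cons ?X_true ?X_false; lra.
Qed.

Lemma tends0_saw b : tends0 (fun k => t (nseq k b)).
Proof.
apply: tends0_shift; apply: (tends0_ext (tends0Z (if b then -1 else 1) (tends0_T b))) => k.
by case: b; rewrite [nseq _ _]/= t_cons; lra.
Qed.

(** The branches meet at the empty [s]: the common limits are 1/2 for [X], 1 for [T] and 0 for [t].
    Longer [s] reduce to shorter ones by the recursion equations. *)
Lemma dyadic_agree_saw : dyadic_agree t.
Proof.
have dyX : dyadic_agree X.
  move=> s; elim: s => [|a s IHs].
    apply: (tends0_ext (tends0Z (- (1 / 2)) (@tends0_exp2N R))) => k.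
    by rewrite /= !X_cons X_true X_false /=; lra.
  by apply: (tends0_ext (tends0Z (1 / 2) IHs)) => k; rewrite !cat_cons !X_cons; lra.
have dyT : dyadic_agree T.
  case=> [|a s].
    by apply: (tends0_ext (@tends0_0 R)) => k; rewrite /= !T_cons X_true X_false; lra.
  apply: (tends0_ext (tends0Z (if a then -1 else 1) (dyX s))) => k.
  by rewrite !cat_cons !T_cons; case: a; lra.
case=> [|a s].
  apply: (tends0_ext (tends0D (tends0_T true) (tends0_T false))) => k.
  by rewrite /= !t_cons; lra.
apply: (tends0_ext (tends0Z (if a then -1 else 1) (dyT s))) => k.
by rewrite !cat_cons !t_cons; case: a; lra.
Qed.

End Saw.

(** * The selector automaton, described by its value functions *)

Section SelectorAutomaton.
Variables (R : realType) (m n : nat) (A : 'I_m.+1 -> 'M[R]_n).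
(** [M p i] is the value function of row [i] after [p] letters [true]; the letter [false] confirms
    the count. A count [p <= m] multiplies by [A_p] and restarts at 0, [m + 1 + j] selects column
    [j] and starts the saw, and [m + n + 1 + j] selects row [j]. The cut at [m + n] separates the
    row counter, where the automaton starts, from the others. *)
Variables (M : nat -> 'I_n -> seq bool -> R) (t : seq bool -> R).

Hypothesis M_nil : forall p i, M p i [::] = 0.
Hypothesis M_cut : forall p i v,
  p = (m + n)%N \/ p = (m + n + n)%N -> M p i (true :: v) = 0.
Hypothesis M_next : forall p i v, (p < m + n + n)%N -> p != (m + n)%N ->
  M p i (true :: v) = M p.+1 i v.
Hypothesis M_letter : forall (a : 'I_m.+1) i v,
  M a i (false :: v) = \sum_j A a i j * M 0 j v.
Hypothesis M_col : forall (j i : 'I_n) v,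
  M (m + j).+1 i (false :: v) = (i == j)%:R * t v.
Hypothesis M_row : forall (j i : 'I_n) v,
  M (m + n + j).+1 i (false :: v) = M 0 j v.

Hypothesis t_bounded : forall v, `|t v| <= 1.
Hypothesis uct : unif_cauchy t.
Hypothesis t_const : forall b, tends0 (fun k => t (nseq k b)).
Hypothesis dyt : dyadic_agree t.
Hypothesis t_nil : t [::] = 0.
Hypothesis t_false : t [:: false] = 1 / 2.

(** A row vector replaces the basis row [i], so that reading a letter turns [r] into [r A_a]. *)
Let Phi p (r : 'rV[R]_n) v : R := \sum_i r ord0 i * M p i v.

Lemma state_cases p : (p <= m + n + n)%N ->
  [\/ exists a : 'I_m.+1, p = a, exists j : 'I_n, p = (m + j).+1
    | exists j : 'I_n, p = (m + n + j).+1].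
Proof.
move=> le_p; have [lt_m|le_m] := ltnP p m.+1; first by constructor 1; exists (Ordinal lt_m).
have [le_mn|lt_mn] := leqP p (m + n).
  have lt : (p - m.+1 < n)%N by lia.
  by constructor 2; exists (Ordinal lt); rewrite /=; lia.
have lt : (p - (m + n).+1 < n)%N by lia.
by constructor 3; exists (Ordinal lt); rewrite /=; lia.
Qed.

Lemma Phi_letter (a : 'I_m.+1) r v : Phi a r (false :: v) = Phi 0 (r *m A a) v.
Proof.
rewrite /Phi; under eq_bigr do rewrite M_letter mulr_sumr.
rewrite exchange_big; apply: eq_bigr => j _; rewrite mxE mulr_suml.
by apply: eq_bigr => i _; rewrite mulrA.
Qed.

Lemma Phi_col (j : 'I_n) r v : Phi (m + j).+1 r (false :: v) = r ord0 j * t v.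
Proof.
rewrite /Phi (bigD1 j) //= M_col eqxx mul1r big1 ?addr0 // => i /negPf neq.
by rewrite M_col neq mul0r mulr0.
Qed.

Lemma Phi_cut r v : Phi (m + n) r (true :: v) = 0.
Proof. by rewrite /Phi big1 // => i _; rewrite M_cut ?mulr0 //; left. Qed.

Lemma Phi_next p r v : (p < m + n)%N -> Phi p r (true :: v) = Phi p.+1 r v.
Proof. by move=> lt_p; apply: eq_bigr => i _; rewrite M_next //; lia. Qed.

Lemma Phi_nil p r : Phi p r [::] = 0.
Proof. by rewrite /Phi big1 // => i _; rewrite M_nil mulr0. Qed.

(** Reading ends in 0 or in a saw value scaled by an entry of some [r A_u]. *)
Lemma Phi_bounded c p r v : (forall u, l1norm (r *m mxword A u) <= c) ->
  (p <= m + n)%N -> `|Phi p r v| <= c.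
Proof.
elim: v p r => [|[] v IHv] p r Hr le_p.
- by rewrite Phi_nil normr0 (le_trans (l1norm_ge0 _) (Hr [::])).
- have [->|neq] := eqVneq p (m + n)%N.
    by rewrite Phi_cut normr0 (le_trans (l1norm_ge0 _) (Hr [::])).
  by rewrite Phi_next; [apply: IHv => //; lia | lia].
have /state_cases[[a ->]|[j ->]|[j E]] : (p <= m + n + n)%N by lia.
- rewrite Phi_letter; apply: IHv => // u.
  by rewrite -mulmxA -mxword_cons; exact: Hr.
- rewrite Phi_col normrM; have := Hr [::]; rewrite mxword_nil mulmx1.
  apply: le_trans; rewrite -[leRHS]mulr1.
  by rewrite ler_pM ?normr_ge0 ?l1norm_entry.
- by lia.
Qed.

(** Outer induction on [l], the number of matrices to be read before the products are small; inner
    induction on the number of letters [true] left before the cut. For [l = 0] the function is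
    bounded by [e], hence oscillates by at most [e + e]. *)
Lemma Phi_cauchy e l r p : 0 < e ->
  (forall u, (l <= size u)%N -> l1norm (r *m mxword A u) <= e) ->
  (p <= m + n)%N -> cauchy_at (e + e) (Phi p r).
Proof.
move=> e0; elim: l r p => [|l IHl] r p Hr le_p.
  by apply: cauchy_at_bounded => v; apply: Phi_bounded => // u; exact: Hr.
have zero q : (q <= m + n)%N -> cauchy_at (e + e) (fun v => Phi q r (false :: v)).
  move=> le_q; have /state_cases[[a ->]|[j ->]|[j E]] : (q <= m + n + n)%N by lia.
  - have Hra u : (l <= size u)%N -> l1norm (r *m A a *m mxword A u) <= e.
      by move=> le_u; rewrite -mulmxA -mxword_cons; exact: Hr.
    have [D HD] := IHl (r *m A a) 0%N Hra isT.
    by exists D => w v v'; rewrite !Phi_letter; exact: HD.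
  - have [D HD] := unif_cauchyZ (r ord0 j) uct (addr_gt0 e0 e0).
    by exists D => w v v'; rewrite !Phi_col; exact: HD.
  - by lia.
have [k] := ubnP (m + n - p); elim: k p le_p => // k IHk p le_p le_k.
apply: (@cauchy_at_cons _ _ _ _ (fun v => Phi p r (true :: v))) (zero p le_p) _ => //.
have [->|neq] := eqVneq p (m + n)%N.
  have [D HD] := cauchy_at0 (addr_gt0 e0 e0).
  by exists D => w v v' _; rewrite !Phi_cut subrr normr0 ltW ?addr_gt0.
have [D HD] : cauchy_at (e + e) (Phi p.+1 r) by apply: IHk; lia.
by exists D => w v v'; rewrite !Phi_next; [exact: HD | lia | lia].
Qed.

Definition start_state (i : 'I_n) : seq bool -> R := M (m + n).+1 i.

Lemma M0_Phi j v : M 0 j v = Phi 0 (delta_mx ord0 j) v.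
Proof.
rewrite /Phi (bigD1 j) //= mxE !eqxx mul1r big1 ?addr0 // => i /negPf neq.
by rewrite mxE neq andbF mul0r.
Qed.

Lemma stable_start_cauchy i : stable A -> unif_cauchy (start_state i).
Proof.
move=> /stableP vanA e e0; have e20 := divr_gt0 e0 (ltr0n R 2).
have M0_cauchy j : cauchy_at e (M 0 j).
  have [l Hl] := vanishingMl (delta_mx ord0 j : 'rV[R]_n) vanA e20.
  have [D HD] := @Phi_cauchy _ l (delta_mx ord0 j) 0 e20 Hl isT.
  by exists D => w v v' /HD; rewrite -splitr !M0_Phi; apply.
suff row_cauchy k : (k < n)%N -> cauchy_at e (M (m + n + k).+1 i).
  by have := row_cauchy 0; rewrite addn0; apply; case: (i) => ?; lia.
have [l] := ubnP (n - k); elim: l k => // l IHl k le_l lt_k.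
apply: (@cauchy_at_cons _ _ _ (M 0 (Ordinal lt_k))
  (if k.+1 == n then fun=> 0 else M (m + n + k.+1).+1 i)) => // [v|v|].
- by rewrite (M_row (Ordinal lt_k)).
- case: eqP => [E|neq]; first by rewrite M_cut //; right; lia.
  by rewrite M_next ?addnS //; lia.
- case: eqP => [_|neq]; first exact: cauchy_at0.
  by apply: IHl; lia.
Qed.

Lemma M_true_iter p i k : (p <= m + n + n)%N -> M p i (nseq k true) = 0.
Proof.
elim: k p => [|k IHk] p le_p; first exact: M_nil.
have [E|ne1] := eqVneq p (m + n)%N; first by rewrite M_cut //; left.
have [E|ne2] := eqVneq p (m + n + n)%N; first by rewrite M_cut //; right.
by rewrite [nseq _ _]/= M_next ?IHk //; lia.
Qed.

Lemma M0_false_iter j k : M 0 j (nseq k false) = 0.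
Proof.
elim: k j => [|k IHk] j; first exact: M_nil.
rewrite [nseq _ _]/= (M_letter ord0) big1 // => i _.
by rewrite IHk mulr0.
Qed.

Lemma M_false_iter p i : (p <= m + n + n)%N -> tends0 (fun k => M p i (nseq k false)).
Proof.
move=> /state_cases[[a ->]|[j ->]|[j ->]]; apply: tends0_shift.
- apply: (tends0_ext (@tends0_0 R)) => k; rewrite [nseq _ _]/= M_letter big1 // => j _.
  by rewrite M0_false_iter mulr0.
- apply: (tends0_ext (tends0Z (i == j)%:R (t_const false))) => k.
  by rewrite [nseq _ _]/= M_col.
- apply: (tends0_ext (@tends0_0 R)) => k.
  by rewrite [nseq _ _]/= M_row M0_false_iter.
Qed.

(** From every state the values at [0 1^k] and at [1 0^k] tend to 0: a run of [true] meets a cut or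
    an end of the saw, and a run of [false] multiplies by [A_0] without selecting a column, or
    follows the saw to its end. Longer [s] follow from the transition equations and [dyt]. *)
Lemma M_dyadic_agree p i : (p <= m + n + n)%N -> dyadic_agree (M p i).
Proof.
have M_true_cases q j : (q <= m + n + n)%N -> (forall v, M q j (true :: v) = 0) \/
    ((q < m + n + n)%N /\ forall v, M q j (true :: v) = M q.+1 j v).
  move=> le_q; have [E|ne1] := eqVneq q (m + n)%N.
    by left=> v; rewrite M_cut //; left.
  have [E|ne2] := eqVneq q (m + n + n)%N; first by left=> v; rewrite M_cut //; right.
  by right; split=> [|v]; [|rewrite M_next //]; lia.
move=> le_p s; elim: s p i le_p => [|a s IHs] p i le_p.
  have false_true : tends0 (fun k => M p i (false :: nseq k true)).
    have /state_cases[[a ->]|[j ->]|[j ->]] := le_p.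
    - apply: (tends0_ext (@tends0_0 R)) => k; rewrite M_letter big1 // => j _.
      by rewrite M_true_iter ?mulr0.
    - by apply: (tends0_ext (tends0Z (i == j)%:R (t_const true))) => k; rewrite M_col.
    - by apply: (tends0_ext (@tends0_0 R)) => k; rewrite M_row M_true_iter.
  have true_false : tends0 (fun k => M p i (true :: nseq k false)).
    have [E|[lt_p E]] := M_true_cases p i le_p.
      by apply: (tends0_ext (@tends0_0 R)) => k; rewrite E.
    by apply: (tends0_ext (M_false_iter i lt_p)) => k; rewrite E.
  apply: (tends0_ext (tends0D false_true (tends0Z (-1) true_false))) => k.
  by rewrite mulN1r.
case: a.
  have [E|[lt_p E]] := M_true_cases p i le_p.
    by apply: (tends0_ext (@tends0_0 R)) => k; rewrite !cat_cons !E subrr.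
  by apply: (tends0_ext (IHs _ i lt_p)) => k; rewrite !cat_cons !E.
have /state_cases[[a ->]|[j ->]|[j ->]] := le_p.
- apply: (tends0_ext (tends0_sum (fun j => tends0Z (A a i j) (IHs 0%N j isT)))) => k.
  rewrite !cat_cons !M_letter -sumrB; apply: eq_bigr => j _.
  by rewrite mulrBr.
- apply: (tends0_ext (tends0Z (i == j)%:R (dyt s))) => k.
  by rewrite !cat_cons !M_col mulrBr.
- by apply: (tends0_ext (IHs 0%N j isT)) => k; rewrite !cat_cons !M_row.
Qed.

Lemma Phi_true_iter p k r v : (p + k <= m + n)%N ->
  Phi p r (nseq k true ++ v) = Phi (p + k) r v.
Proof.
elim: k p => [|k IHk] p le_pk; first by rewrite addn0.
by rewrite [nseq _ _]/= cat_cons Phi_next ?IHk ?addSnnS //; lia.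
Qed.

Let encode (w : seq 'I_m.+1) : seq bool :=
  flatten [seq rcons (nseq (a : 'I_m.+1) true) false | a <- w].

Lemma Phi_encode w r v : Phi 0 r (encode w ++ v) = Phi 0 (r *m mxword A w) v.
Proof.
elim: w r => [|a w IHw] r; first by rewrite mxword_nil mulmx1.
rewrite /encode /= -/(encode w) -catA -cats1 -catA Phi_true_iter ?add0n ?cat1s.
  by rewrite Phi_letter IHw -mulmxA -mxword_cons.
by have := ltn_ord a; lia.
Qed.

Lemma size_encode w : (size w <= size (encode w))%N.
Proof.
elim: w => // a w IHw; rewrite /encode /= size_cat size_rcons -/(encode w).
by rewrite addSn ltnS (leq_trans IHw) // leq_addl.
Qed.

Lemma start_true_iter i k v : (k < n)%N ->
  start_state i (nseq k true ++ v) = M (m + n + k).+1 i v.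
Proof.
rewrite /start_state; elim: k v => [|k IHk] v lt_k; first by rewrite addn0.
rewrite -[k.+1]addn1 nseqD -catA IHk; last by lia.
by rewrite /= M_next; [rewrite addn1 addnS | lia | lia].
Qed.

(** The block selects row [i], overriding the row [o] of the start, then reads [w] and selects
    column [j]. *)
Lemma start_entry (o i j : 'I_n) w v :
  start_state o ((nseq i true ++ false :: encode w ++ nseq (m + j).+1 true ++ [:: false]) ++ v)
  = mxword A w i j * t v.
Proof.
rewrite -catA start_true_iter // cat_cons M_row M0_Phi -!catA Phi_encode.
rewrite Phi_true_iter ?add0n ?cat1s ?Phi_col; last by have := ltn_ord j; lia.
by rewrite -rowE mxE.
Qed.

(** The saw takes the values 0 at the empty word and 1/2 at [[:: false]], so the oscillation after
    the block of [start_entry] is at least half the absolute value of the entry. *)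
Lemma start_cauchy_stable i : unif_cauchy (start_state i) -> stable A.
Proof.
move=> ucs; apply/stableP => e e0.
(* The factor 2 compensates the saw value 1/2, and [(n * n).+1] exceeds the number of entries. *)
have d0 : 0 < 2 * (n * n).+1%:R :> R by rewrite mulr_gt0.
have [D HD] := ucs _ (divr_gt0 e0 d0); exists D => w le_w.
have entry_le (k j : 'I_n) : `|mxword A w k j| <= e / (n * n).+1%:R.
  set b := nseq k true ++ false :: encode w ++ nseq (m + j).+1 true ++ [:: false].
  have le_b : (D <= size b)%N.
    have -> : b = (nseq k true ++ [:: false]) ++ encode w ++ nseq (m + j).+1 true ++ [:: false].
      by rewrite -catA.
    by rewrite size_cat [size (encode _ ++ _)]size_cat addnCA (leq_trans le_w) // (leq_trans (size_encode w)) // leq_addr.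
  have := HD (take D b) (drop D b) (drop D b ++ [:: false]).
  rewrite size_takel // catA cat_take_drop -[X in start_state i X]cats0 !start_entry.
  rewrite t_nil t_false mulr0 sub0r normrN normrM => /(_ erefl).
  rewrite [`|1 / 2|]ger0_norm ?divr_ge0 // div1r invfM [2^-1 * _^-1]mulrC mulrA.
  by rewrite ler_pM2r ?invr_gt0.
apply: le_trans (l1norm_le entry_le) _.
rewrite mulrA ler_pdivrMr ?ltr0n // mulrC ler_wpM2l ?ler_nat //; exact: ltW.
Qed.

End SelectorAutomaton.

Section TabulatedAutomaton.
Variables (R : realType) (K : nat) (tr : bool -> nat -> nat -> R) (fin : nat -> R).

(** States are plain natural numbers, so that transition equations reduce to index arithmetic. *)
Fixpoint run (v : seq bool) (q : nat) : R :=
  if v is a :: v' then \sum_(0 <= k < K) tr a q k * run v' k else fin q.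

Lemma mxword_run v (i : 'I_K) j :
  (mxword (fun a => \matrix_(p, q) tr a p q) v *m \col_p fin p : 'cV[R]_K) i j = run v i.
Proof.
elim: v i => [|a v IHv] i; first by rewrite mxword_nil mul1mx mxE.
rewrite mxword_cons -mulmxA mxE /= big_mkord.
by apply: eq_bigr => k _; rewrite IHv mxE.
Qed.

End TabulatedAutomaton.

(** * The selector automaton as a coded automaton *)

Section SelectorCodes.
Variables (R : realType) (N : numbering R).

(* States: [0], [1], [2], [3] compute the saw, the tent, the identity and [1];
   [(p * n + i).+4] is in row [i] of the block reached after [p] letters [true]. *)
Definition selector_size (m n : nat) : nat := ((m + n + n).+1 * n).+4.

Definition delta_code (q c : nat) : nat := if q == c then code_1 N else code_0 N.

Definition selector_final (q : nat) : nat := (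
  if q == 0 then code_0 N else if q <= 2 then code_half N else delta_code q 3)%N.

Definition selector_false (m n mats q k : nat) : nat := (
  if q == 0 then delta_code k 1 else
  if q == 1 then delta_code k 2 else
  if q == 2 then (if k == 2 then code_half N else code_0 N) else
  if q == 3 then delta_code k 3 else
  let p := (q - 4) %/ n in let i := (q - 4) %% n in
  if p <= m then
    (if (4 <= k) && (k - 4 < n) then ent (nthc mats p) i (k - 4) else code_0 N)
  else if p <= m + n then
    (if (k == 0) && (i == p - m.+1) then code_1 N else code_0 N)
  else delta_code k (p - (m + n).+1).+4)%N.

(** Adding [n] to a block state moves it to the same row of the next block. At [p = m + n + n] the
    target [q + n] is out of range, which produces the second cut. *)
Definition selector_true (m n q k : nat) : nat := (
  if q == 0 then (if k == 1 then code_m1 N else code_0 N) else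
  if q == 1 then (if k == 2 then code_m1 N else delta_code k 3) else
  if q == 2 then (if k == 2 then code_half N else if k == 3 then code_half N else code_0 N) else
  if q == 3 then delta_code k 3 else
  if (q - 4) %/ n == m + n then code_0 N else delta_code k (q + n))%N.

Variables (m n mats : nat).
Let K := selector_size m n.
Let entry (a : bool) (q k : nat) : R :=
  val N (if a then selector_true m n q k else selector_false m n mats q k).
Let psi := run K entry (fun q => val N (selector_final q)).

Lemma sum_selector (F : nat -> R) : \sum_(0 <= k < K) F k =
  F 0 + (F 1%N + (F 2%N + (F 3%N + \sum_(0 <= k < (m + n + n).+1 * n) F k.+4))).
Proof. by rewrite /K /selector_size !big_nat_recl. Qed.

Lemma val_delta_code q c : val N (delta_code q c) = (q == c)%:R.
Proof. by rewrite /delta_code; case: eqP => _; rewrite ?val_code_1 ?val_code_0. Qed.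

Lemma sum_delta (L c : nat) (F : nat -> R) :
  \sum_(0 <= k < L) (k == c)%:R * F k = if (c < L)%N then F c else 0.
Proof.
rewrite big_mkord; case: ltnP => [lt_c|le_L].
  rewrite (bigD1 (Ordinal lt_c)) //= eqxx mul1r big1 ?addr0 // => i neq.
  have /negPf -> : (i : nat) != c by apply: contraNneq neq => E; apply/eqP/val_inj.
  by rewrite mul0r.
rewrite big1 // => i _; have /negPf -> : (i : nat) != c; last by rewrite mul0r.
by rewrite neq_ltn (leq_trans (ltn_ord i)).
Qed.

Let M (p : nat) (i : 'I_n) (v : seq bool) : R := psi v (p * n + i).+4.

Let selector_valE := (val_delta_code, val_code_0, val_code_1, val_code_half, val_code_m1).

Lemma psi_one v : psi v 3 = 1.
Proof.
elim: v => [|a v IHv]; first by rewrite /psi /= val_code_1.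
rewrite /psi /= -/psi sum_selector /entry.
rewrite big1 => [|k _]; last by case: a; rewrite /= !selector_valE mul0r.
by case: a; rewrite /= !selector_valE IHv /=; ring.
Qed.

Lemma psi_X a v : psi (a :: v) 2 = (a%:R + psi v 2) / 2.
Proof.
rewrite /psi /= -/psi sum_selector /entry.
rewrite big1 => [|k _]; last by case: a; rewrite /= !selector_valE mul0r.
by case: a; rewrite /= !selector_valE psi_one /=; ring.
Qed.

Lemma psi_T a v : psi (a :: v) 1 = if a then 1 - psi v 2 else psi v 2.
Proof.
rewrite /psi /= -/psi sum_selector /entry.
rewrite big1 => [|k _]; last by case: a; rewrite /= !selector_valE mul0r.
by case: a; rewrite /= !selector_valE ?psi_one /=; ring.
Qed.

Lemma psi_t a v : psi (a :: v) 0 = if a then - psi v 1 else psi v 1.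
Proof.
rewrite /psi /= -/psi sum_selector /entry.
rewrite big1 => [|k _]; last by case: a; rewrite /= !selector_valE mul0r.
by case: a; rewrite /= !selector_valE /=; ring.
Qed.

Lemma block_index p (i : 'I_n) :
  (((p * n + i).+4 - 4) %/ n = p)%N /\ (((p * n + i).+4 - 4) %% n = i)%N.
Proof.
have n0 : (0 < n)%N by apply: leq_trans (ltn_ord i).
have -> : ((p * n + i).+4 - 4 = p * n + i)%N by lia.
by rewrite divnMDl // divn_small // addn0 modnMDl modn_small.
Qed.

Lemma psi_nil_M p i : M p i [::] = 0.
Proof. by rewrite /M /psi /= val_code_0. Qed.

Lemma psi_true p (i : 'I_n) v : p != (m + n)%N -> M p i (true :: v) =
  if (p < m + n + n)%N then M p.+1 i v else 0.
Proof.
move=> neq; have [Ep _] := block_index p i.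
have En : ((p * n + i).+4 + n = (p.+1 * n + i).+4)%N by rewrite mulSn; lia.
rewrite /M /psi /= -/psi sum_selector /entry /selector_true Ep (negPf neq) En /=.
rewrite !selector_valE /= !mul0r !add0r.
under eq_bigr do rewrite selector_valE !eqSS.
rewrite (sum_delta _ _ (fun k => psi v k.+4)).
suff -> : (p.+1 * n + i < (m + n + n).+1 * n)%N = (p < m + n + n)%N by [].
have lt_i := ltn_ord i; have n0 : (0 < n)%N by apply: leq_trans lt_i.
apply/idP/idP => [lt|lt_p].
  suff : (p * n < (m + n + n) * n)%N by rewrite ltn_pmul2r.
  by move: lt; rewrite !mulSn; lia.
have : (p.+1 * n <= (m + n + n) * n)%N by rewrite leq_mul2r lt_p orbT.
by rewrite !mulSn; lia.
Qed.

Lemma psi_cut p (i : 'I_n) v : p = (m + n)%N \/ p = (m + n + n)%N -> M p i (true :: v) = 0.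
Proof.
have [->|neq] := eqVneq p (m + n)%N; last first.
  by case=> E; [rewrite E eqxx in neq | rewrite psi_true // E ltnn].
move=> _; have [Ep _] := block_index (m + n) i.
rewrite /M /psi /= -/psi /entry /selector_true Ep eqxx /=.
by rewrite big1 // => k _; rewrite val_code_0 mul0r.
Qed.

Lemma psi_letter p (i : 'I_n) v : (p <= m)%N -> M p i (false :: v) =
  \sum_(j < n) val N (ent (nthc mats p) i j) * M 0 j v.
Proof.
move=> le_p; have [Ep Ei] := block_index p i.
rewrite /M /psi /= -/psi sum_selector /entry /selector_false Ep Ei le_p /=.
rewrite !val_code_0 !mul0r !add0r big_mkord.
have le_n : (n <= (m + n + n).+1 * n)%N by rewrite leq_pmull.
rewrite [RHS](big_ord_widen _ (fun j => val N (ent (nthc mats p) i j) * psi v (0 * n + j).+4) le_n).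
rewrite [RHS]big_mkcond; apply: eq_bigr => k _ /=.
have -> : (k.+4 - 4 = k)%N by lia.
by rewrite mul0n; case: ifP => _ //; rewrite val_code_0 mul0r.
Qed.

Lemma psi_col (j i : 'I_n) v : M (m + j).+1 i (false :: v) = (i == j)%:R * psi v 0.
Proof.
have [Ep Ei] := block_index (m + j).+1 i.
rewrite /M /psi /= -/psi sum_selector /entry /selector_false Ep Ei /=.
have -> : (m + j < m)%N = false by lia.
have -> : (m + j < m + n)%N by have := ltn_ord j; lia.
have -> : ((m + j).+1 - m.+1 = j)%N by lia.
rewrite /= !val_code_0 !mul0r !add0r big1 => [|k _]; last by rewrite mul0r.
by rewrite addr0; case: eqP => [/val_inj ->|neq]; rewrite ?val_code_1 ?val_code_0;
  case: eqP => // E; case: neq; rewrite E.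
Qed.

Lemma psi_row (j i : 'I_n) v : M (m + n + j).+1 i (false :: v) = M 0 j v.
Proof.
have [Ep Ei] := block_index (m + n + j).+1 i.
rewrite /M /psi /= -/psi sum_selector /entry /selector_false Ep Ei /=.
have -> : (m + n + j < m)%N = false by lia.
have -> : (m + n + j < m + n)%N = false by lia.
have -> : ((m + n + j).+1 - (m + n).+1 = j)%N by lia.
rewrite /= !selector_valE /= !mul0r !add0r.
under eq_bigr do rewrite selector_valE !eqSS.
rewrite (sum_delta _ _ (fun k => psi v k.+4)) mul0n add0n ifT //.
by apply: leq_trans (ltn_ord j) _; rewrite leq_pmull.
Qed.

Definition selector_wfa : wfa nat bool := Wfa
  (\matrix_(i < 1, j < K) delta_code j ((m + n).+1 * n).+4)
  (\matrix_(i < K, j < 1) selector_final i)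
  (fun a : bool => \matrix_(i < K, j < K)
     if a then selector_true m n i j else selector_false m n mats i j).

Definition selector_wfac : nat := code_seq
  [:: K; tabmx 1 K (fun _ q => delta_code q ((m + n).+1 * n).+4);
      tabmx K 1 (fun q _ => selector_final q);
      tabmx K K (selector_false m n mats); tabmx K K (selector_true m n)].

Lemma code_selector_wfa : code_wfa selector_wfa = selector_wfac.
Proof.
rewrite /code_wfa /selector_wfac; congr (code_seq [:: _; _; _; _; _]);
  by apply: code_mxE => i j; rewrite mxE.
Qed.

Let A : wfa R bool := map_wfa (val N) selector_wfa.

Lemma selector_transE : trans A = fun a => \matrix_(i, j) entry a i j.
Proof. by apply/funext => a; apply/matrixP => i j; rewrite !mxE. Qed.

Lemma selector_finalE : final A = \col_i val N (selector_final i).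
Proof. by apply/matrixP => i j; rewrite !mxE. Qed.

Lemma selector_word v (i : 'I_K) j : (mxword (trans A) v *m final A) i j = psi v i.
Proof. by rewrite selector_transE selector_finalE; exact: mxword_run. Qed.

Lemma selector_state q : (q < K)%N -> [\/ q = 0%N, q = 1%N, q = 2%N | q = 3%N] \/
  exists p (i : 'I_n), (p <= m + n + n)%N /\ q = (p * n + i).+4.
Proof.
case: q => [|[|[|[|q]]]] lt_q; [by left; constructor 1|by left; constructor 2
  |by left; constructor 3|by left; constructor 4|right].
have {}lt_q : (q < (m + n + n).+1 * n)%N by [].
have n0 : (0 < n)%N by case: (n) lt_q => //; rewrite muln0.
exists (q %/ n)%N, (Ordinal (ltn_pmod q n0)); split; last by rewrite /= -divn_eq.
by rewrite -ltnS ltn_divLR.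
Qed.

(** The identity is checked state by state: the values of [psi] at the two one-letter words add up
    to twice the value at the empty word. *)
Lemma selector_average_preserving : average_preserving A.
Proof.
rewrite /average_preserving big_bool card_bool; apply/matrixP => i j.
rewrite mxE [RHS]mxE -[trans A true](mxword_seq1 (trans A)) -[trans A false](mxword_seq1 (trans A)).
rewrite !selector_word -[final A]mul1mx -(mxword_nil (trans A)) selector_word.
have [[]->|[p [k [le_p ->]]]] := selector_state (ltn_ord i).
- by rewrite !psi_t /psi /= !selector_valE; ring.
- by rewrite !psi_T /psi /= !selector_valE; field.
- by rewrite !psi_X /psi /= !selector_valE; field.
- by rewrite !psi_one; ring.
rewrite -/(M p k _) -/(M p k _) -/(M p k _) psi_nil_M mulr0.
have -> : M p k [:: true] = 0.
  have [E|neq] := eqVneq p (m + n)%N; first by apply: psi_cut; left.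
  by rewrite psi_true //; case: ifP => // _; rewrite psi_nil_M.
have [[a ->]|[b ->]|[b ->]] := state_cases le_p.
- have le_a : (a <= m)%N by rewrite -ltnS.
  rewrite (psi_letter _ _ le_a) big1 ?addr0 // => l _.
  by rewrite psi_nil_M mulr0.
- by rewrite psi_col [psi [::] 0]val_code_0 mulr0 addr0.
- by rewrite psi_row psi_nil_M addr0.
Qed.

Lemma selector_continuousP : everywhere_continuous A <->
  stable (fun a : 'I_m.+1 => mxval N n n (nthc mats a)).
Proof.
rewrite (everywhere_continuousP selector_average_preserving).
have wordE v : wfa_word A v =
    if (((m + n).+1 * n).+4 < K)%N then psi v ((m + n).+1 * n).+4 else 0.
  rewrite /wfa_word -mulmxA mxE -sum_delta big_mkord; apply: eq_bigr => i _.
  by rewrite selector_word !mxE val_delta_code.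
(* For [n = 0] the start state is out of range, so the automaton computes 0, and the empty matrices
   are stable. *)
have [n0|n_gt0] := posnP n.
  have {}wordE v : wfa_word A v = 0 by rewrite wordE /K /selector_size n0 !muln0.
  split=> _.
    move=> w; apply/cvg_mx0P => e e0; exists 0%N => k _.
    rewrite /l1norm big1 ?normr0 ?ltW // => i; have := ltn_ord i; lia.
  split=> [e e0|s e e0]; exists 0%N => *; rewrite !wordE subrr normr0; exact: ltW.
pose o := Ordinal n_gt0.
have {}wordE : wfa_word A = start_state m M o.
  apply/funext => v; rewrite wordE /start_state /M addn0 ifT //.
  by rewrite /K /selector_size ltnS ltnS ltnS ltnS ltn_pmul2r //; lia.
pose B (a : 'I_m.+1) := mxval N n n (nthc mats a).
have letter (a : 'I_m.+1) i v : M a i (false :: v) = \sum_j B a i j * M 0 j v.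
  have le_a : (a <= m)%N by rewrite -ltnS.
  by rewrite (psi_letter _ _ le_a); apply: eq_bigr => j _; rewrite mxE.
have next p (i : 'I_n) v : (p < m + n + n)%N -> p != (m + n)%N ->
    M p i (true :: v) = M p.+1 i v by move=> lt_p /psi_true ->; rewrite lt_p.
have T_nil : psi [::] 1 = 1 / 2 by rewrite /psi /= val_code_half.
have X_nil : psi [::] 2 = 1 / 2 by rewrite /psi /= val_code_half.
have t_nil : psi [::] 0 = 0 by rewrite /psi /= val_code_0.
have t_false : psi [:: false] 0 = 1 / 2 by rewrite psi_t.
have uct := @unif_cauchy_saw R (psi^~ 0%N) (psi^~ 1%N) (psi^~ 2%N) X_nil psi_X psi_T psi_t.
have t_const b := @tends0_saw R (psi^~ 0%N) (psi^~ 1%N) (psi^~ 2%N) X_nil psi_X psi_T psi_t b.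
have dyt := @dyadic_agree_saw R (psi^~ 0%N) (psi^~ 1%N) (psi^~ 2%N) X_nil psi_X psi_T psi_t.
have t_bounded := @saw_bounded R (psi^~ 0%N) (psi^~ 1%N) (psi^~ 2%N) X_nil psi_X T_nil psi_T t_nil psi_t.
rewrite wordE; split=> [[ucs _]|stB].
  have stB := @start_cauchy_stable R m n B M (psi^~ 0%N) next letter psi_col psi_row t_nil t_false o ucs.
  exact: stB.
split.
  exact: (@stable_start_cauchy R m n B M (psi^~ 0%N) psi_nil_M psi_cut next letter psi_col psi_row
            t_bounded uct o stB).
apply: (@M_dyadic_agree R m n B M (psi^~ 0%N) psi_nil_M psi_cut next letter psi_col psi_row
          t_const dyt (m + n).+1 o).
by lia.
Qed.

End SelectorCodes.

(** A many-one reduction: the selector automaton is the only query, and its answer is returned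
    unchanged. *)
Lemma stability_reducible (R : realType) (N : numbering R) :
  reducible (matrix_product_stability N) (ap_wfa_uniform_continuity N).
Proof.
pose out x := selector_wfac N (nthc x 1) (nthc x 0) (nthc x 2).
have [co Ho] : computable out.
  rewrite /out /selector_wfac /selector_size /selector_false /selector_true.
  rewrite /selector_final /delta_code /=.
  by repeat number_step.
exists (PComp POracle co) => F _; rewrite /= in Ho *.
pose mats := nthc (code_mx_family F) 2.
have En : nthc (code_mx_family F) 0 = mf_dim F by rewrite nthc_code.
have Em : nthc (code_mx_family F) 1 = mf_card F by rewrite nthc_code.
have matsE (a : 'I_(mf_card F).+1) : nthc mats a = code_mx (mf_mx F a).
  rewrite /mats nthc_code /= nthc_code (nth_map a) ?size_enum_ord //.
  by rewrite nth_ord_enum.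
have stE : everywhere_continuous (map_wfa (val N) (selector_wfa N (mf_card F) (mf_dim F) mats))
    <-> stable (fun a => map_mx (val N) (mf_mx F a)).
  rewrite selector_continuousP; under eq_fun do rewrite matsE mxval_code_mx.
  by [].
have ansE (b : nat) : answer (stable (fun a => map_mx (val N) (mf_mx F a))) b ->
    eval (oracle_of (ap_wfa_uniform_continuity N)) (PComp POracle co) (code_mx_family F) b.
  move=> ans_b; exists (out (code_mx_family F)); first exact: eval_no_oracle (Ho _).
  exists (selector_wfa N (mf_card F) (mf_dim F) mats); split.
  - exact: selector_average_preserving.
  - by rewrite /= code_selector_wfa /out En Em.
  - by case: ans_b => -[/stE ? ?]; [left|right].
have [st|nst] := pselect (stable (fun a => map_mx (val N) (mf_mx F a))).
  by exists 1%N; [apply: ansE; left | left].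
by exists 0%N; [apply: ansE; right | right].
Qed.

Theorem theorem61 (R : realType) (N : numbering R) :
  reducible (matrix_product_stability N) (ap_wfa_uniform_continuity N) /\
  reducible (ap_wfa_uniform_continuity N) (matrix_product_stability N).
Proof. by split; [exact: stability_reducible | exact: uniform_continuity_reducible]. Qed.
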